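(* Let $k$, $\varphi$, $b$, $a_1,\dots,a_d$, $u_{a_i}(s)$, $\mathbf V_{\mathfrak r}(s)$, $(M,D_t)$ and $(M_\varphi,D_s)$ be as in the context. For each $i=1,\dots,d$, let $\vec Y_{a_i,1}(t),\dots,\vec Y_{a_i,\mathfrak r}(t)$ be any basis of the space of horizontal elements of $(M,D_t)$ at $a_i$. For $i\in\{1,\dots,d\}$ and $j\in\{1,\dots,\mathfrak r\}$ let $w_{i,j}(s)\in k[[s-b]]^{\mathfrak rd}$ be the vector whose entry in position $(l-1)d+i$ is the $l$-th component of $\vec Y_{a_i,j}(u_{a_i}(s))$ ($l=1,\dots,\mathfrak r$), all other entries being $0$. Then the $\mathfrak rd$ vectors $\mathbf V_{\mathfrak r}(s)\,w_{i,j}(s)$, $1\le i\le d$, $1\le j\le\mathfrak r$, form a basis of the space of horizontal elements of $(M_\varphi,D_s)$ at $b$ (written in coordinates with respect to the basis $e_1,te_1,\dots,t^{d-1}e_1,\dots,t^{d-1}e_{\mathfrak r}$).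
   Context: $k$ is an algebraically closed field complete for a non-archimedean absolute value extending the $p$-adic one on $\mathbb Q_p$. ${\mathscr D}_t^\pm$ denotes the unit disc (open or closed) in coordinate $t$ with ring of analytic functions $\mathcal O_t^\pm$; $\mathcal O_t(a,r^-)$ is the ring of power series in $t-a$ converging on $|t-a|<r$. $\varphi:{\mathscr D}_t^\pm\to{\mathscr D}_s^\pm$ is a finite étale morphism of degree $d$ of unit discs (both open or both closed), $s=f(t)$, $f\in\mathcal O_t^\pm$, $f'$ invertible; $P(s,X)\in\mathcal O_s^\pm[X]$ is the unique monic degree-$d$ polynomial with $P(f(t),t)=0$. Fix $b\in{\mathscr D}_s^\pm(k)$, $\varphi^{-1}(b)=\{a_1,\dots,a_d\}$. $u_{a_i}(s)\in k[[s-b]]$ is the power series with constant term $a_i$ and $P(s,u_{a_i}(s))=0$ (positive radius of convergence). $\mathbf U(s)=(u_{a_i}(s)^{j-1})_{1\le i,j\le d}$, $\mathbf V(s)=\mathbf U(s)^{-1}$, and $\mathbf V_{\mathfrak r}(s)$ is block diagonal with $\mathfrak r$ blocks $\mathbf V(s)$. $(M,D_t)$ is a differential module of rank $\mathfrak r$: a free $\mathcal O_t^\pm$-module with $k$-linear $D_t$ satisfying $D_t(gm)=\frac{dg}{dt}m+gD_t(m)$, with fixed basis $e_1,\dots,e_{\mathfrak r}$. A horizontal element at $a\in{\mathscr D}_t^\pm(k)$ is an element of $\ker D_t$ on $M\otimes\mathcal O_t(a,r^-)$ for some $r>0$, identified with its coordinate vector in $k[[t-a]]^{\mathfrak r}$.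 The direct image $(M_\varphi,D_s)$ is $M$ as an $\mathcal O_s^\pm$-module via $s=f(t)$ with $D_s(m)=\frac{1}{f'(t)}D_t(m)$, with basis $e_1,te_1,\dots,t^{d-1}e_1,e_2,\dots,t^{d-1}e_{\mathfrak r}$; horizontal elements at $b$ are elements of $\ker D_s$ on $M_\varphi\otimes\mathcal O_s(b,r^-)$ for some $r>0$, identified with coordinate vectors in $k[[s-b]]^{\mathfrak rd}$. *)

(* Defs.v *)
From HB Require Import structures.
From mathcomp Require Import all_boot all_order all_algebra.
From mathcomp Require Import boolp classical_sets reals.
Set Implicit Arguments. Unset Strict Implicit. Unset Printing Implicit Defensive.
Import Order.TTheory GRing.Theory Num.Theory.
Local Open Scope ring_scope.

Section Valued.
Variables (R : realType) (k : fieldType).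

Record nonarch_abs (v : k -> R) : Prop := {
  nabs_ge0 : forall x, 0 <= v x;
  nabs_eq0 : forall x, (v x == 0) = (x == 0);
  nabs_mul : forall x y, v (x * y) = v x * v y;
  nabs_ultra : forall x y, v (x + y) <= Num.max (v x) (v y) }.

Definition cvg_to (v : k -> R) (u : nat -> k) (l : k) : Prop :=
  forall e : R, 0 < e -> exists N : nat, forall n, (N <= n)%N -> v (u n - l) < e.

Definition cauchy_seq (v : k -> R) (u : nat -> k) : Prop :=
  forall e : R, 0 < e -> exists N : nat,
    forall n m, (N <= n)%N -> (N <= m)%N -> v (u n - u m) < e.

Definition complete_abs (v : k -> R) : Prop :=
  forall u, cauchy_seq v u -> exists l, cvg_to v u l.

Definition series_to (v : k -> R) (u : nat -> k) (l : k) : Prop :=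
  cvg_to v (fun n => \sum_(i < n) u i) l.

(* the sum of a series (meaningful when it converges) *)
Definition sumk (v : k -> R) (u : nat -> k) : k :=
  xget 0 [set l | series_to v u l].

(* c : ps k stands for sum_n c n (t - a)^n, the centre a being given by context *)
Definition ps := nat -> k.

Definition ps0 : ps := fun _ => 0.
Definition ps1 : ps := fun n => (n == 0%N)%:R.
Definition psX (j : nat) : ps := fun n => (n == j)%:R.
Definition psadd (c e : ps) : ps := fun n => c n + e n.
Definition psmul (c e : ps) : ps :=
  fun n => \sum_(i < n.+1) c i * e (n - i)%N.
Definition psderiv (c : ps) : ps := fun n => c n.+1 * (n.+1)%:R.
Definition pspow (c : ps) (m : nat) : ps := iter m (psmul c) ps1.
(* formal composition c(w) for w with zero constant term *)
Definition pscomp (c w : ps) : ps :=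
  fun m => \sum_(i < m.+1) c i * pspow w i m.
Definition psnoconst (w : ps) : ps := fun n => if n == 0%N then 0 else w n.

Definition in_disc (v : k -> R) (cl : bool) (c0 : k) (rho : R) (x : k) : bool :=
  if cl then v (x - c0) <= rho else v (x - c0) < rho.

Definition conv_on (v : k -> R) (cl : bool) (c0 : k) (rho : R) (c : ps) : Prop :=
  forall x, in_disc v cl c0 rho x ->
    exists l, series_to v (fun n => c n * (x - c0) ^+ n) l.

Definition analytic (v : k -> R) (cl : bool) (c : ps) : Prop :=
  conv_on v cl 0 1 c.

Definition pseval (v : k -> R) (c : ps) (x : k) : k :=
  sumk v (fun n => c n * x ^+ n).

(* Taylor re-expansion at a of sum_n c n t^n : coefficients in powers of (t - a) *)
Definition expand (v : k -> R) (c : ps) (a : k) : ps :=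
  fun m => sumk v (fun n => c (n + m)%N * ('C(n + m, m))%:R * a ^+ n).

(* phi : D_t -> D_s, s = f(t), is a finite etale morphism of degree d:
   f in O_t, f maps the disc to the disc, f' is invertible in O_t, and
   O_t is a free O_s-module (via s = f(t)) with basis 1, t, ..., t^(d-1). *)
Definition finite_etale_disc (v : k -> R) (cl : bool) (f : ps) (d : nat) : Prop :=
  [/\ analytic v cl f,
      (forall x, in_disc v cl 0 1 x -> in_disc v cl 0 1 (pseval v f x)),
      (exists g, analytic v cl g /\ psmul (psderiv f) g = ps1),
      (forall g, analytic v cl g -> exists h : 'I_d -> ps,
          (forall m, analytic v cl (h m)) /\
          forall x, in_disc v cl 0 1 x ->
            pseval v g x = \sum_(m < d) pseval v (h m) (pseval v f x) * x ^+ m) &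
      (forall h : 'I_d -> ps, (forall m, analytic v cl (h m)) ->
          (forall x, in_disc v cl 0 1 x ->
             \sum_(m < d) pseval v (h m) (pseval v f x) * x ^+ m = 0) ->
          forall m, h m = ps0)].

(* A differential module free on a basis (e_l)_{l in A} is given by its
   connection matrix G: D(e_l') = sum_l G l l' e_l, G l l' analytic on the disc.
   Coordinates Y (in powers of (t - a)) of a horizontal element at a:
   Y converges on some disc |t - a| < rho, rho > 0, and D(sum_l Y_l e_l) = 0,
   i.e. Y_l' + sum_l' G_{l l'} Y_l' = 0 (G expanded at a). *)
Definition horizontal (v : k -> R) (A : finType) (G : A -> A -> ps) (a : k)
    (Y : A -> ps) : Prop :=
  (exists rho : R, 0 < rho /\ forall l, conv_on v false a rho (Y l)) /\
  (forall l n, psderiv (Y l) n + \sum_(l' : A) psmul (expand v (G l l') a) (Y l') n = 0).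

Definition is_basis (J A : finType) (S : (A -> ps) -> Prop) (F : J -> A -> ps) : Prop :=
  [/\ forall j, S (F j),
      (forall c : J -> k, (forall a n, \sum_(j : J) c j * F j a n = 0) ->
          forall j, c j = 0) &
      (forall Z, S Z -> exists c : J -> k,
          forall a n, Z a n = \sum_(j : J) c j * F j a n)].

End Valued.

(* Main.v *)
(* Near a_i take x = f(t) - b as a function of t - a_i. Since P(b, X) has the d
   distinct roots a_1, ..., a_d, they are simple, and as P(f(t), t) = 0 both t and
   u_i(f(t)) are roots of P(f(t), X) in k[[t - a_i]] with constant term a_i; hence
   u_i(f(t)) = t. Multiplying the coordinates Z of an element of M_phi at b by U
   gives, for each i, the vector sum_m u_i^m Z_{l,m}, whose pullback by f is the
   expansion at a_i of the element sum Z_{l,m}(f(t)) t^m e_l of M. As D_s = D_t / f',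
   Z satisfies the horizontality equation iff all these pullbacks do. Inverting U
   and substituting back t = u_i(s) gives the asserted basis. Positivity of the
   radii of convergence follows from ultrametric estimates on the recursions
   defining the inverse series and the inverse matrix. *)
Require Import Defs.
From HB Require Import structures.
From mathcomp Require Import all_boot all_order all_algebra.
From mathcomp Require Import boolp classical_sets reals.
From mathcomp Require Import ring lra zify.
Set Implicit Arguments. Unset Strict Implicit. Unset Printing Implicit Defensive.
Import Order.TTheory GRing.Theory Num.Theory.
Local Open Scope ring_scope.

(** * The ring of formal power series *)

Section PowerSeriesRing.
Variable k : fieldType.
Implicit Types (c e w : ps k) (p q : {poly k}) (n m i j : nat).

(** The relations tying [P] and [H] to [f] are identities between values on the disc, whereas the
    conclusion concerns formal series at b. The bridge is [germ]: a series with geometrically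
    bounded coefficients that sums to a given function near 0. Such a series is determined by its
    values ([germ_uniq]), because powers of p are nonzero of arbitrarily small absolute value; after
    this transfer everything happens in the commutative ring of formal series. No inverse of a
    substitution is ever constructed: the identity [pscomp w x = psX k 1], with w = u_i - a_i and x
    = f(t) - b, makes x of order exactly one, so that substituting x is injective and undoes
    substituting w. Convergence is carried by the single condition [gb], which survives sums,
    products, substitution and the passage to inverse series and inverse matrices. *)

Lemma psP c e : (forall n, c n = e n) -> c = e.
Proof. by move=> ce; apply: funext. Qed.

Definition pstrunc N c : {poly k} := \poly_(i < N) c i.

Lemma coef_pstrunc N c i : (i < N)%N -> (pstrunc N c)`_i = c i.
Proof. by move=> iN; rewrite coef_poly iN. Qed.

(** A coefficient of a product depends only on coefficients of index at most [n], so associativity,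
    commutativity and the Leibniz rule can be read off truncated polynomials. *)
Lemma psmul_coef n c e p q :
  (forall i, (i <= n)%N -> c i = p`_i) -> (forall i, (i <= n)%N -> e i = q`_i) ->
  psmul c e n = (p * q)`_n.
Proof.
move=> cp eq; rewrite coefM; apply: eq_bigr => i _.
by rewrite cp -1?ltnS// eq// leq_subr.
Qed.

Definition psopp c : ps k := fun n => - c n.

Lemma psaddA : associative (@psadd k).
Proof. by move=> a b c; apply: psP => n; rewrite /psadd addrA. Qed.
Lemma psaddC : commutative (@psadd k).
Proof. by move=> a b; apply: psP => n; rewrite /psadd addrC. Qed.
Lemma psadd0 : left_id (ps0 k) (@psadd k).
Proof. by move=> a; apply: psP => n; rewrite /psadd add0r. Qed.
Lemma psaddN : left_inverse (ps0 k) psopp (@psadd k).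
Proof. by move=> a; apply: psP => n; rewrite /psadd /psopp addNr. Qed.

HB.instance Definition _ := gen_eqMixin (ps k).
HB.instance Definition _ := gen_choiceMixin (ps k).
HB.instance Definition _ :=
  GRing.isZmodule.Build (ps k) psaddA psaddC psadd0 psaddN.

Lemma psmulA : associative (@psmul k).
Proof.
move=> a b c; apply: psP => n; pose t := pstrunc n.+1.
have Ht e i : (i <= n)%N -> e i = (t e)`_i by move=> le_in; rewrite coef_pstrunc.
have HM e1 e2 i : (i <= n)%N -> psmul e1 e2 i = (t e1 * t e2)`_i.
  by move=> le_in; apply: psmul_coef => j le_ji; apply: Ht; apply: leq_trans le_in.
by rewrite (psmul_coef (Ht a) (HM b c)) (psmul_coef (HM a b) (Ht c)) mulrA.
Qed.

Lemma psmulC : commutative (@psmul k).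
Proof.
move=> a b; apply: psP => n; pose ta := pstrunc n.+1 a; pose tb := pstrunc n.+1 b.
have Ha i : (i <= n)%N -> a i = ta`_i by move=> le_in; rewrite coef_pstrunc.
have Hb i : (i <= n)%N -> b i = tb`_i by move=> le_in; rewrite coef_pstrunc.
by rewrite (psmul_coef Ha Hb) (psmul_coef Hb Ha) mulrC.
Qed.

Lemma psmul1 : left_id (ps1 k) (@psmul k).
Proof.
move=> a; apply: psP => n; rewrite /psmul big_ord_recl /= mul1r subn0.
by rewrite big1 ?addr0// => i _; rewrite mul0r.
Qed.

Lemma psmulDl : left_distributive (@psmul k) (@psadd k).
Proof.
move=> a b c; apply: psP => n; rewrite /psmul /psadd -big_split /=.
by apply: eq_bigr => i _; rewrite mulrDl.
Qed.

Lemma ps1_neq0 : ps1 k != 0.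
Proof.
by apply/eqP => /(congr1 (fun c : ps k => c 0%N)) /eqP; rewrite /ps1 oner_eq0.
Qed.

HB.instance Definition _ := GRing.Zmodule_isComNzRing.Build (ps k)
  psmulA psmulC psmul1 psmulDl ps1_neq0.

Lemma psaddE c e n : (c + e) n = c n + e n. Proof. by []. Qed.
Lemma psoppE c n : (- c) n = - c n. Proof. by []. Qed.
Lemma psoneE n : (1 : ps k) n = (n == 0%N)%:R. Proof. by []. Qed.

Lemma psmul_sum c e n : (c * e) n = \sum_(i < n.+1) c i * e (n - i)%N.
Proof. by []. Qed.

Lemma ps_sumE (I : Type) (r : seq I) (Q : pred I) (F : I -> ps k) n :
  (\sum_(i <- r | Q i) F i) n = \sum_(i <- r | Q i) F i n.
Proof. by apply: (big_morph (fun c : ps k => c n)). Qed.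

Lemma pspowE c m : pspow c m = c ^+ m.
Proof. by elim: m => // m IHm; rewrite exprS -IHm. Qed.

Lemma psmul_coef0 c e : (c * e) 0%N = c 0%N * e 0%N.
Proof. by rewrite psmul_sum big_ord1. Qed.

Definition psC (a : k) : ps k := fun n => if n == 0%N then a else 0.

Lemma psC_is_additive : zmod_morphism psC.
Proof. by move=> a b; apply: psP => -[|n]; rewrite psaddE psoppE //= subr0. Qed.

Lemma psCmulE a c n : (psC a * c) n = a * c n.
Proof.
rewrite psmul_sum big_ord_recl subn0 /= big1 ?addr0// => i _.
by rewrite /psC /= mul0r.
Qed.

Lemma psC_is_monoid_morphism : monoid_morphism psC.
Proof.
split; first by apply: psP => -[].
by move=> a b; apply: psP => -[|n]; rewrite psCmulE //= mulr0.
Qed.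

HB.instance Definition _ := GRing.isZmodMorphism.Build k (ps k) psC psC_is_additive.
HB.instance Definition _ := GRing.isMonoidMorphism.Build k (ps k) psC psC_is_monoid_morphism.

Definition coef0 c : k := c 0%N.
Lemma coef0_is_additive : zmod_morphism coef0. Proof. by []. Qed.
Lemma coef0_is_monoid_morphism : monoid_morphism coef0.
Proof. by split=> // c e; rewrite /coef0 psmul_coef0. Qed.
HB.instance Definition _ := GRing.isZmodMorphism.Build (ps k) k coef0 coef0_is_additive.
HB.instance Definition _ := GRing.isMonoidMorphism.Build (ps k) k coef0 coef0_is_monoid_morphism.

Lemma psXmulE m c n : (psX k m * c) n = if (m <= n)%N then c (n - m)%N else 0.
Proof.
rewrite psmul_sum; case: leqP => [le_mn|lt_nm].
  rewrite (bigD1 (Ordinal (le_mn : (m < n.+1)%N))) //= /psX eqxx mul1r.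
  rewrite big1 ?addr0// => i; rewrite -val_eqE /= => /negPf ->.
  by rewrite mul0r.
rewrite big1// => i _; rewrite /psX; case: eqP => [im|]; last by rewrite mul0r.
by move: (ltn_ord i); rewrite im ltnS leqNgt lt_nm.
Qed.

Lemma psXD m n : psX k (m + n) = psX k m * psX k n.
Proof.
apply: psP => i; rewrite psXmulE /psX; case: leqP => [le_mi|lt_im].
  by congr (_%:R); apply/eqP/eqP; lia.
by case: eqP => // im; move: lt_im; rewrite im ltnNge leq_addr.
Qed.

Lemma psX0 : psX k 0 = 1. Proof. by []. Qed.

Lemma psXn m : psX k m = psX k 1 ^+ m.
Proof. by elim: m => // m IHm; rewrite exprS -IHm -psXD. Qed.

Lemma pow_coef_small w m n : w 0%N = 0 -> (n < m)%N -> (w ^+ m) n = 0.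
Proof.
move=> w0; elim: m n => // m IHm n lt_nm; rewrite exprS psmul_sum big1// => -[[|i] /= Hi] _.
  by rewrite w0 mul0r.
by rewrite IHm ?mulr0 //=; lia.
Qed.

Lemma pow_coef_diag w m : w 0%N = 0 -> (w ^+ m) m = w 1%N ^+ m.
Proof.
move=> w0; elim: m => // m IHm; rewrite [in LHS]exprS psmul_sum.
rewrite !big_ord_recl /= w0 mul0r add0r subSS subn0 IHm -exprS.
by rewrite big1 ?addr0 // => i _; rewrite pow_coef_small ?mulr0 //= /bump /=;
  move: (ltn_ord i); lia.
Qed.

Lemma ps_lreg c e : c 0%N != 0 -> c * e = 0 -> e = 0.
Proof.
move=> c0 ce; apply: psP; elim/ltn_ind => n IHn.
have := congr1 (fun c : ps k => c n) ce; rewrite psmul_sum big_ord_recl subn0 big1.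
  by rewrite addr0 => /eqP; rewrite mulf_eq0 (negPf c0) => /eqP.
by move=> i _; rewrite IHn ?mulr0 //= /bump /=; move: (ltn_ord i); lia.
Qed.

(* Continuity for the X-adic topology. *)
Definition ps_cont (L : ps k -> ps k) :=
  zmod_morphism L /\
  forall n, exists N, forall c, (forall j, (j < N)%N -> c j = 0) -> L c n = 0.

(** Up to any given order a series is a finite sum of monomials, so a continuous additive map is
    determined by its values on them. Multiplicativity of substitution, the chain rule and [pscompK]
    are reduced to monomials in this way. *)
Lemma ps_cont_ext L1 L2 : ps_cont L1 -> ps_cont L2 ->
  (forall a i, L1 (psC a * psX k i) = L2 (psC a * psX k i)) ->
  forall c, L1 c = L2 c.
Proof.
move=> [add1 cont1] [add2 cont2] eqL c; apply: psP => n.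
have [N1 H1] := cont1 n; have [N2 H2] := cont2 n.
pose N := maxn N1 N2; pose t := \sum_(i < N) psC (c i) * psX k i.
have tlow j : (j < N)%N -> (c - t) j = 0.
  move=> jN; rewrite psaddE psoppE /t ps_sumE (bigD1 (Ordinal jN)) //= psCmulE /psX eqxx.
  rewrite mulr1 big1 ?addr0 ?subrr// => i; rewrite -val_eqE /= => neq.
  by rewrite psCmulE /psX eq_sym (negPf neq) mulr0.
have L_0 (L : ps k -> ps k) : zmod_morphism L -> L 0 = 0.
  by move=> LB; rewrite -[X in L X](subrr 0) LB subrr.
have L_sum (L : ps k -> ps k) : zmod_morphism L -> L t = \sum_(i < N) L (psC (c i) * psX k i).
  move=> LB; have LD : {morph L : x y / x + y}.
    by move=> x y; rewrite -{1}[y]opprK LB -[- y]sub0r LB (L_0 _ LB) sub0r opprK.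
  exact: (big_morph L LD (L_0 _ LB)).
have Lt : L1 t = L2 t.
  by rewrite !L_sum//; apply: eq_bigr => i _.
have E (L : ps k -> ps k) M : zmod_morphism L ->
    (forall c, (forall j, (j < M)%N -> c j = 0) -> L c n = 0) ->
    (M <= N)%N -> L c n = L t n.
  move=> LB LC MN; apply/eqP; rewrite -subr_eq0 -psoppE -psaddE -LB; apply/eqP.
  by apply: LC => j jM; rewrite tlow // (leq_trans jM).
by rewrite (E L1 N1) ?(E L2 N2) ?Lt ?leq_maxl ?leq_maxr.
Qed.

Lemma psmul_cont e (L : ps k -> ps k) : ps_cont L ->  ps_cont (fun c => L c * e).
Proof.
move=> [LB LC]; split=> [c1 c2|n]; first by rewrite LB mulrBl.
(* Coefficient [n] of the product involves all coefficients of [L c] up to [n], so a single bound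
   has to serve them all. *)
have [N HN] : exists N, forall i, (i <= n)%N -> forall c,
    (forall j, (j < N)%N -> c j = 0) -> L c i = 0.
  elim: n => [|n [N1 H1]].
    have [N HN] := LC 0%N; exists N => i; rewrite leqn0 => /eqP ->; exact: HN.
  have [N2 H2] := LC n.+1; exists (maxn N1 N2) => i le_in c cN.
  move: le_in; rewrite leq_eqVlt => /predU1P[->|le_in].
    by apply: H2 => j jN; rewrite cN // leq_max jN orbT.
  by apply: H1 => // j jN; rewrite cN // leq_max jN.
exists N => c cN; rewrite psmul_sum big1// => i _.
by rewrite HN ?mul0r -1?ltnS.
Qed.

Lemma ps_cont_comp (L1 L2 : ps k -> ps k) : (forall n c, (forall j, (j < n)%N -> c j = 0) ->
    forall j, (j < n)%N -> L2 c j = 0) -> zmod_morphism L2 ->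
  ps_cont L1 -> ps_cont (fun c => L1 (L2 c)).
Proof.
move=> L2low L2B [L1B L1C]; split=> [c1 c2|n]; first by rewrite L2B L1B.
by have [N HN] := L1C n; exists N => c cN; apply: HN; apply: L2low.
Qed.

Lemma psmul_low e n c : (forall j, (j < n)%N -> c j = 0) ->
  forall j, (j < n)%N -> (c * e) j = 0.
Proof.
move=> c0 j jn; rewrite psmul_sum big1// => i _.
by rewrite c0 ?mul0r//; move: (ltn_ord i); lia.
Qed.

(** * Formal derivation *)

Lemma psderivB : zmod_morphism (@psderiv k).
Proof. by move=> c e; apply: psP => n; rewrite /psderiv psaddE psoppE mulrBl. Qed.

Lemma psderiv_sum (I : Type) (r : seq I) (F : I -> ps k) :
  psderiv (\sum_(i <- r) F i) = \sum_(i <- r) psderiv (F i).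
Proof. by apply: psP => n; rewrite /psderiv !ps_sumE mulr_suml. Qed.

Lemma psderivM c e : psderiv (c * e) = psderiv c * e + c * psderiv e.
Proof.
apply: psP => n; pose t := pstrunc n.+2.
have Ht c1 i : (i <= n.+1)%N -> c1 i = (t c1)`_i by move=> ?; rewrite coef_pstrunc.
have Ht' c1 i : (i <= n)%N -> c1 i = (t c1)`_i by move=> ?; rewrite -Ht// leqW.
have Hd c1 i : (i <= n)%N -> psderiv c1 i = (t c1)^`()`_i.
  by move=> le_in; rewrite /psderiv coef_deriv -Ht// mulr_natr.
rewrite psaddE {1}/psderiv -[c * e]/(psmul c e) (psmul_coef (Ht c) (Ht e)).
rewrite mulr_natr -coef_deriv derivM coefD.
by congr (_ + _); symmetry; [exact: psmul_coef (Hd c) (Ht' e) | exact: psmul_coef (Ht' c) (Hd e)].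
Qed.

Lemma psderivC a c : psderiv (psC a * c) = psC a * psderiv c.
Proof. by apply: psP => n; rewrite /psderiv !psCmulE mulrA. Qed.

Lemma psderivX c i : psderiv (c ^+ i) = (c ^+ i.-1 * psderiv c) *+ i.
Proof.
elim: i => [|i IHi]; first by apply: psP => n; rewrite /psderiv expr0 psoneE mul0r.
rewrite exprS psderivM IHi /= mulrS mulrC; congr (_ + _).
case: i {IHi} => [|i]; first by rewrite !mulr0n mulr0.
by rewrite mulrnAr mulrA -exprS.
Qed.

Lemma psderiv_psX i : psderiv (psX k i) = psX k i.-1 *+ i.
Proof.
rewrite psXn psderivX (_ : psderiv (psX k 1) = 1) ?mulr1 -?psXn//.
by apply: psP => -[|n]; rewrite /psderiv /psX ?mul1r ?mul0r.
Qed.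

(** * Substitution of a series without constant term *)

Section Composition.
Variable w : ps k.
Hypothesis w0 : w 0%N = 0.

Lemma pscompE c n : pscomp c w n = \sum_(i < n.+1) c i * (w ^+ i) n.
Proof. by apply: eq_bigr => i _; rewrite pspowE. Qed.

Lemma pscomp_is_additive : zmod_morphism (fun c => pscomp c w).
Proof.
move=> c e; apply: psP => n; rewrite psaddE psoppE !pscompE -sumrB.
by apply: eq_bigr => i _; rewrite -mulrBl.
Qed.

Lemma pscomp_low c n : (forall j, (j < n.+1)%N -> c j = 0) -> pscomp c w n = 0.
Proof. by move=> c0; rewrite pscompE big1// => i _; rewrite c0 ?mul0r. Qed.

Lemma pscomp_cont : ps_cont (fun c => pscomp c w).
Proof.
split=> [|n]; first exact: pscomp_is_additive.
by exists n.+1 => c; apply: pscomp_low.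
Qed.

Lemma pscomp_monom a i : pscomp (psC a * psX k i) w = psC a * w ^+ i.
Proof.
apply: psP => n; rewrite pscompE psCmulE.
have E j : (psC a * psX k i) j * (w ^+ j) n = if j == i then a * (w ^+ i) n else 0.
  by rewrite psCmulE /psX; case: eqP => [->|_]; rewrite ?mulr1 ?mulr0 ?mul0r.
case: (leqP i n) => [le_in|lt_ni].
  rewrite (bigD1 (Ordinal (le_in : (i < n.+1)%N))) //= E eqxx big1 ?addr0// => j.
  by rewrite -val_eqE E /= => /negPf ->.
rewrite pow_coef_small// mulr0 big1// => j _; rewrite E; case: eqP => // ji.
by rewrite pow_coef_small ?mulr0.
Qed.

Lemma pscompC a : pscomp (psC a) w = psC a.
Proof. by have := pscomp_monom a 0; rewrite psX0 expr0 !mulr1. Qed.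

Lemma pscomp_is_monoid_morphism : monoid_morphism (fun c => pscomp c w).
Proof.
split=> [|c e]; first by have := pscompC 1; rewrite rmorph1.
have mulB x : zmod_morphism (fun y => y * x) by move=> y z; rewrite mulrBl.
move: c; apply: ps_cont_ext.
- apply: (@ps_cont_comp (fun c => pscomp c w) (fun c => c * e)); [|exact: mulB|exact: pscomp_cont].
  by move=> n c; apply: psmul_low.
- by apply: (@psmul_cont _ (fun c => pscomp c w)); apply: pscomp_cont.
move=> a i; rewrite pscomp_monom [X in pscomp X _]mulrC [RHS]mulrC; move: e; apply: ps_cont_ext.
- apply: (@ps_cont_comp (fun c => pscomp c w) (fun c => c * (psC a * psX k i)));
    [|exact: mulB|exact: pscomp_cont].
  by move=> n c; apply: psmul_low.
- by apply: (@psmul_cont _ (fun c => pscomp c w)); apply: pscomp_cont.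
move=> b j; rewrite pscomp_monom mulrACA -rmorphM -psXD pscomp_monom.
by rewrite rmorphM exprD mulrACA.
Qed.

(** Multiplicativity relies on [w] having no constant term; taking that fact as the argument lets
    the ring morphism structure be attached to [pssubst w0]. *)
Definition pssubst of w 0%N = 0 := fun c => pscomp c w.

HB.instance Definition _ := GRing.isZmodMorphism.Build (ps k) (ps k)
  (pssubst w0) pscomp_is_additive.
HB.instance Definition _ := GRing.isMonoidMorphism.Build (ps k) (ps k)
  (pssubst w0) pscomp_is_monoid_morphism.

Lemma pscomp0 : pscomp 0 w = 0. Proof. exact: (rmorph0 (pssubst w0)). Qed.
Lemma pscompD c e : pscomp (c + e) w = pscomp c w + pscomp e w.
Proof. exact: (rmorphD (pssubst w0)). Qed.
Lemma pscompM c e : pscomp (c * e) w = pscomp c w * pscomp e w.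
Proof. exact: (rmorphM (pssubst w0)). Qed.
Lemma pscompXn c n : pscomp (c ^+ n) w = pscomp c w ^+ n.
Proof. exact: (rmorphXn (pssubst w0)). Qed.
Lemma pscomp_sum (I : Type) (r : seq I) (Q : pred I) (F : I -> ps k) :
  pscomp (\sum_(i <- r | Q i) F i) w = \sum_(i <- r | Q i) pscomp (F i) w.
Proof. exact: (rmorph_sum (pssubst w0)). Qed.

(** The linear system for the coefficients of [c] is triangular, with the nonzero diagonal entries
    [w 1%N ^+ n]. *)
Lemma pscomp_eq0 c : w 1%N != 0 -> pscomp c w = 0 -> c = 0.
Proof.
move=> w1 cw; apply: psP; elim/ltn_ind => n IHn.
have := congr1 (fun c : ps k => c n) cw; rewrite pscompE big_ord_recr /= big1.
  rewrite add0r pow_coef_diag// => /eqP; rewrite mulf_eq0 expf_eq0 (negPf w1) andbF orbF.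
  by move/eqP.
by move=> i _; rewrite IHn ?mul0r.
Qed.

Lemma pscomp_inj c e : w 1%N != 0 -> pscomp c w = pscomp e w -> c = e.
Proof.
move=> w1 cew; apply/eqP; rewrite -subr_eq0; apply/eqP/pscomp_eq0 => //.
by rewrite pscomp_is_additive cew subrr.
Qed.

Lemma pscomp_chain c : psderiv (pscomp c w) = pscomp (psderiv c) w * psderiv w.
Proof.
move: c; apply: ps_cont_ext.
- split=> [c e|n]; first by rewrite pscomp_is_additive psderivB.
  by exists n.+2 => c c0; rewrite /psderiv pscomp_low ?mul0r.
- apply: (@psmul_cont _ (fun c => pscomp (psderiv c) w)).
  split=> [c e|n]; first by rewrite psderivB pscomp_is_additive.
  by exists n.+2 => c c0; apply: pscomp_low => j jn; rewrite /psderiv c0 ?mul0r.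
move=> a i; rewrite pscomp_monom psderivC psderivX psderivC psderiv_psX.
have -> : psC a * (psX k i.-1 *+ i) = psC (a *+ i) * psX k i.-1.
  by rewrite rmorphMn mulrnAr mulrnAl.
by rewrite pscomp_monom rmorphMn mulrnAr !mulrnAl mulrA.
Qed.

End Composition.

Lemma pscomp_inv_coef1 w x : w 0%N = 0 -> pscomp w x = psX k 1 -> w 1%N * x 1%N = 1.
Proof.
move=> w0 /(congr1 (fun c : ps k => c 1%N)).
by rewrite pscompE !big_ord_recl big_ord0 /= w0 mul0r add0r addr0 expr1.
Qed.

Lemma pscompK c w x : w 0%N = 0 -> x 0%N = 0 -> pscomp w x = psX k 1 ->
  pscomp (pscomp c w) x = c.
Proof.
move=> w0 x0 wx; move: c.
apply: (ps_cont_ext (L1 := fun c => pscomp (pscomp c w) x) (L2 := fun c => c)).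
- apply: (@ps_cont_comp (fun c => pscomp c x) (fun c => pscomp c w)).
  + move=> n c c0 j jn; apply: pscomp_low => i ij; apply: c0.
    exact: leq_trans ij jn.
  + exact: pscomp_is_additive.
  + exact: pscomp_cont.
- by split=> // n; exists n.+1 => c; apply.
move=> a i; rewrite pscomp_monom// pscompM// pscompXn// pscompC//.
by rewrite wx -psXn.
Qed.

Lemma psnoconstE w : psnoconst w = w - psC (w 0%N).
Proof. by apply: psP => -[|n]; rewrite psaddE psoppE ?subrr ?subr0. Qed.

(** The uniqueness half of Hensel's lemma. Write q = q1 (X - e). Since [c] and [e] have the same
    constant term, q1(c) has as constant term the derivative of the reduced polynomial at that
    point; being nonzero, it allows q1(c) to be cancelled from q1(c) (c - e) = 0. *)
Lemma ps_simple_root (q : {poly ps k}) (c e : ps k) :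
  q.[c] = 0 -> q.[e] = 0 -> c 0%N = e 0%N ->
  (map_poly coef0 q)^`().[c 0%N] != 0 -> c = e.
Proof.
move=> qc /eqP/factor_theorem[q1 Eq] ce0 q'c; apply/eqP; rewrite -subr_eq0; apply/eqP.
apply: (@ps_lreg q1.[c]); last by rewrite -qc Eq hornerM hornerXsubC.
move: q'c; rewrite Eq rmorphM rmorphB /= map_polyX map_polyC /= derivM derivXsubC.
rewrite hornerD !hornerM hornerXsubC hornerC mulr1 -[coef0 e]/(e 0%N) ce0 subrr.
by rewrite mulr0 add0r -ce0 -[c 0%N]/(coef0 c) horner_map.
Qed.

(* Here [t] is a root of P(s, X) in the local coordinate, [x] the expansion of
   s - b, and the hypothesis expresses that H is the matrix of D_s = D_t / f'. *)
Lemma direct_image_ode (A : finType) (d : nat) (x t : ps k)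
    (H : A * 'I_d -> A * 'I_d -> ps k) (G : A -> A -> ps k) (Z : A * 'I_d -> ps k) :
  x 0%N = 0 -> psderiv t = 1 ->
  (forall l l' (m' : 'I_d),
    psderiv x * \sum_(m < d) pscomp (H (l, m) (l', m')) x * t ^+ m =
    (if l == l' then t ^+ m'.-1 *+ m' else 0) + t ^+ m' * G l l') ->
  let y l := \sum_(m < d) t ^+ m * pscomp (Z (l, m)) x in
  forall l, psderiv x *
    (\sum_(m < d) t ^+ m * pscomp (psderiv (Z (l, m)) + \sum_lm H (l, m) lm * Z lm) x) =
  psderiv (y l) + \sum_l' G l l' * y l'.
Proof.
move=> x0 t' HH y l.
have y' : psderiv (y l) = \sum_(m < d) (t ^+ m.-1 *+ m * pscomp (Z (l, m)) x +
    t ^+ m * (pscomp (psderiv (Z (l, m))) x * psderiv x)).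
  by rewrite /y psderiv_sum; apply: eq_bigr => m _; rewrite psderivM psderivX t' mulr1 pscomp_chain.
have -> : \sum_(m < d) t ^+ m *
    pscomp (psderiv (Z (l, m)) + \sum_lm H (l, m) lm * Z lm) x =
    \sum_(m < d) t ^+ m * pscomp (psderiv (Z (l, m))) x +
    \sum_lm (\sum_(m < d) pscomp (H (l, m) lm) x * t ^+ m) * pscomp (Z lm) x.
  rewrite [X in _ = _ + X](eq_bigr _ (fun lm _ => mulr_suml _ _ _ _)).
  rewrite exchange_big -big_split /=; apply: eq_bigr => m _.
  rewrite pscompD// pscomp_sum// mulrDr mulr_sumr; congr (_ + _).
  by apply: eq_bigr => lm _; rewrite pscompM//; ring.
rewrite mulrDr y' big_split /= [RHS]addrAC [LHS]addrC.
congr (_ + _); last by rewrite mulr_sumr; apply: eq_bigr => m _; ring.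
rewrite mulr_sumr.
transitivity (\sum_l' \sum_(m' < d)
    ((if l == l' then t ^+ m'.-1 *+ m' else 0) + t ^+ m' * G l l') *
    pscomp (Z (l', m')) x).
  by rewrite pair_bigA; apply: eq_bigr => -[l' m'] _; rewrite mulrA HH.
(* The terms m t^(m-1) produced by differentiating powers of [t] are spread over a sum supported at
   l' = l, to match the Kronecker term of the matrix identity. *)
have -> : \sum_(m < d) t ^+ m.-1 *+ m * pscomp (Z (l, m)) x = \sum_l' if l == l' then
    \sum_(m < d) t ^+ m.-1 *+ m * pscomp (Z (l', m)) x else 0.
  by rewrite -big_mkcond /= (big_pred1 l)// => l'; rewrite eq_sym.
rewrite -big_split /=; apply: eq_bigr => l' _.
rewrite mulr_sumr; case: eqP => [<-|_].
  by rewrite -big_split /=; apply: eq_bigr => m _; ring.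
by rewrite add0r; apply: eq_bigr => m _; ring.
Qed.

End PowerSeriesRing.

(** * Series over a complete non-archimedean field *)

Section NonArchimedeanSeries.
Variables (R : realType) (k : fieldType) (v : k -> R).
Hypotheses (Hv : nonarch_abs v) (Hc : complete_abs v).
Implicit Types (c e w : ps k) (x y l : k) (B eps : R).

Let v_ge0 := nabs_ge0 Hv.
Let vM := nabs_mul Hv.

Lemma vabs0 : v 0 = 0. Proof. by apply/eqP; rewrite (nabs_eq0 Hv). Qed.

Lemma vabs1 : v 1 = 1.
Proof.
have : v 1 != 0 by rewrite (nabs_eq0 Hv) oner_eq0.
by move/mulfI; apply; rewrite -vM !mulr1.
Qed.

Lemma vabsX x n : v (x ^+ n) = v x ^+ n.
Proof. by elim: n => [|n IHn]; rewrite ?expr0 ?vabs1// !exprS vM IHn. Qed.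

Lemma vabsN x : v (- x) = v x.
Proof.
have vN1 : v (- 1) = 1.
  by apply/eqP; rewrite -(@eqrXn2 _ 2)// -vabsX sqrrN expr1n vabs1 expr1n.
by rewrite -mulN1r vM vN1 mul1r.
Qed.

Lemma vabs_gt0 x : (0 < v x) = (x != 0).
Proof. by rewrite lt_neqAle v_ge0 andbT eq_sym (nabs_eq0 Hv). Qed.

Lemma vabsD_le x y B : v x <= B -> v y <= B -> v (x + y) <= B.
Proof. by move=> xB yB; apply: le_trans (nabs_ultra Hv x y) _; rewrite ge_max xB. Qed.

Lemma vabsD_lt x y B : v x < B -> v y < B -> v (x + y) < B.
Proof. by move=> xB yB; apply: le_lt_trans (nabs_ultra Hv x y) _; rewrite gt_max xB. Qed.

Lemma vabsB_lt x y B : v x < B -> v y < B -> v (x - y) < B.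
Proof. by move=> xB yB; apply: vabsD_lt; rewrite ?vabsN. Qed.

Lemma vabs_sum_le (I : Type) (r : seq I) (Q : pred I) (F : I -> k) B :
  0 <= B -> (forall i, Q i -> v (F i) <= B) -> v (\sum_(i <- r | Q i) F i) <= B.
Proof.
move=> B0 FB; apply: (big_ind (fun x => v x <= B)) => //; first by rewrite vabs0.
by move=> x y; apply: vabsD_le.
Qed.

Lemma vabs_nat n : v n%:R <= 1.
Proof.
elim: n => [|n IHn]; first by rewrite vabs0.
by rewrite -addn1 natrD vabsD_le// vabs1.
Qed.

Definition tend0 (u : nat -> k) : Prop :=
  forall eps, 0 < eps -> exists N, forall n, (N <= n)%N -> v (u n) < eps.

Lemma eq_tend0 u w : tend0 w -> (forall n, u n = w n) -> tend0 u.
Proof. by move=> w0 uw eps /w0[N HN]; exists N => n; rewrite uw; apply: HN. Qed.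

Lemma tend0D u w : tend0 u -> tend0 w -> tend0 (fun n => u n + w n).
Proof.
move=> u0 w0 eps eps0; have [N1 H1] := u0 _ eps0; have [N2 H2] := w0 _ eps0.
exists (maxn N1 N2) => n; rewrite geq_max => /andP[n1 n2].
by apply: vabsD_lt; [apply: H1|apply: H2].
Qed.

Lemma tend0Z x u : tend0 u -> tend0 (fun n => x * u n).
Proof.
move=> u0 eps eps0; have vx1 : 0 < v x + 1 by rewrite ltr_wpDl.
have [N HN] := u0 _ (divr_gt0 eps0 vx1).
exists N => n /HN; rewrite ltr_pdivlMr// => H; rewrite vM; apply: le_lt_trans H.
by rewrite mulrC ler_wpM2l// lerDl.
Qed.

Lemma tend0_le u (q : nat -> R) :
  (forall eps, 0 < eps -> exists N, forall n, (N <= n)%N -> q n < eps) ->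
  (forall n, v (u n) <= q n) -> tend0 u.
Proof.
move=> q0 uq eps /q0[N HN]; exists N => n /HN; exact: le_lt_trans.
Qed.

Lemma tend0_const_eq0 x : tend0 (fun=> x) -> x = 0.
Proof.
move=> x0; apply/eqP; apply/negPn/negP; rewrite -vabs_gt0 => vx.
by have [N /(_ N (leqnn N))] := x0 _ vx; rewrite ltxx.
Qed.

Lemma cvg_to_uniq u l l' : cvg_to v u l -> cvg_to v u l' -> l = l'.
Proof.
move=> ul ul'; apply/eqP; rewrite -subr_eq0; apply/eqP/tend0_const_eq0.
apply: eq_tend0 (tend0D (tend0Z (- 1) ul) ul') _ => n /=.
by ring.
Qed.

Lemma series_to_uniq u l l' : series_to v u l -> series_to v u l' -> l = l'.
Proof. exact: cvg_to_uniq. Qed.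

Lemma eq_series_to u w l : series_to v w l -> (forall n, u n = w n) -> series_to v u l.
Proof.
move=> H uw; apply: (eq_tend0 H) => n; congr (_ - _).
by apply: eq_bigr => i _; rewrite uw.
Qed.

Lemma sumkE u l : series_to v u l -> sumk v u = l.
Proof. by move=> ul; apply: xget_unique => // y yl; apply: series_to_uniq yl ul. Qed.

Lemma series_toD u w l l' : series_to v u l -> series_to v w l' ->
  series_to v (fun n => u n + w n) (l + l').
Proof.
move=> ul wl; apply: eq_tend0 (tend0D ul wl) _ => n.
by rewrite big_split /=; ring.
Qed.

Lemma series_toZ x u l : series_to v u l -> series_to v (fun n => x * u n) (x * l).
Proof.
move=> ul; apply: eq_tend0 (tend0Z x ul) _ => n.
by rewrite mulrBr mulr_sumr.
Qed.

Lemma series_to_fin u N : (forall n, (N <= n)%N -> u n = 0) ->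
  series_to v u (\sum_(i < N) u i).
Proof.
move=> u0 eps eps0; exists N => n le_Nn.
rewrite -(subnKC le_Nn) big_split_ord /= addrAC subrr add0r big1 ?vabs0//.
by move=> i _; rewrite u0// leq_addr.
Qed.

Lemma series_shift m u l : series_to v u l ->
  series_to v (fun n => if (m <= n)%N then u (n - m)%N else 0) l.
Proof.
move=> ul eps /ul[N HN]; exists (m + N)%N => n le_n.
have -> : n = (m + (n - m))%N by rewrite subnKC// (leq_trans (leq_addr N m)).
rewrite big_split_ord /= big1 ?add0r => [|i _]; last by rewrite leqNgt ltn_ord.
under eq_bigr do rewrite leq_addr addKn.
by apply: HN; lia.
Qed.

Lemma series_to_tail u l N B : 0 <= B -> series_to v u l ->
  (forall n, (N <= n)%N -> v (u n) <= B) -> v (l - \sum_(i < N) u i) <= B.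
Proof.
move=> B0 ul uB; rewrite leNgt; apply/negP => lt_B.
have [M HM] := ul _ (le_lt_trans B0 lt_B).
have := HM (N + M)%N (leq_addl _ _); rewrite big_split_ord /=.
set S := \sum_(i < N) u i; set T := \sum_(i < M) _.
have TB : v T <= B by apply: vabs_sum_le => // i _; apply: uB; apply: leq_addr.
suff -> : l - S = T - (S + T - l).
  move=> H; have := nabs_ultra Hv T (- (S + T - l)); rewrite vabsN le_max.
  have E : T - (S + T - l) = l - S by ring.
  move: H lt_B; rewrite -E => H lt_B.
  by rewrite !leNgt H (le_lt_trans TB lt_B).
by ring.
Qed.

Lemma series_le u l B : 0 <= B -> series_to v u l -> (forall n, v (u n) <= B) -> v l <= B.
Proof.
move=> B0 ul uB; have := series_to_tail (N := 0%N) B0 ul (fun n _ => uB n).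
by rewrite big_ord0 subr0.
Qed.

Lemma series_to_tend0 u l : series_to v u l -> tend0 u.
Proof.
move=> ul eps /ul[N HN]; exists N => n le_Nn.
have -> : u n = (\sum_(i < n.+1) u i - l) - (\sum_(i < n) u i - l).
  by rewrite big_ord_recr /=; ring.
by apply: vabsB_lt; apply: HN => //; apply: leqW.
Qed.

Lemma series_exists u : tend0 u -> exists l, series_to v u l.
Proof.
move=> u0; apply: Hc => eps eps0; have [N HN] := u0 _ (divr_gt0 eps0 (ltr0Sn R 1)).
have H m : (N <= m)%N -> v (\sum_(i < m) u i - \sum_(i < N) u i) < eps.
  move=> le_Nm; rewrite -(subnKC le_Nm) big_split_ord /= addrAC subrr add0r.
  apply: le_lt_trans (_ : eps / 2 < _); last lra.
  apply: vabs_sum_le => [|i _]; first lra.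
  by apply/ltW/HN/leq_addr.
exists N => n m Nn Nm; rewrite -[_ - _](subrKA (\sum_(i < N) u i)) -[X in _ + X]opprB.
by apply: vabsB_lt; apply: H.
Qed.

Lemma tend0_bounded u : tend0 u -> exists B, 0 <= B /\ forall n, v (u n) <= B.
Proof.
move=> u0; have [N HN] := u0 _ ltr01; exists (1 + \sum_(i < N) v (u i)).
have S0 : 0 <= \sum_(i < N) v (u i) by apply: sumr_ge0 => i _.
split=> [|n]; first by rewrite addr_ge0.
case: (leqP N n) => [/HN /ltW H|lt_nN]; first by apply: le_trans H _; rewrite lerDl.
by rewrite (bigD1 (Ordinal lt_nN))//= addrCA lerDl addr_ge0// sumr_ge0.
Qed.

(** The interchange of summations behind products, composition and recentring. Truncated at M, the
    two sums differ by the tails beyond M of the first M rows; these are uniformly small, and the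
    ultrametric inequality keeps the same bound for their sum, whatever the number of rows. *)
Lemma series_exchange (A : nat -> nat -> k) (S : nat -> k) :
  (forall j n, (n < j)%N -> A j n = 0) ->
  (forall eps, 0 < eps -> exists N, forall n, (N <= n)%N -> forall j, v (A j n) <= eps) ->
  (forall j, series_to v (A j) (S j)) ->
  tend0 (fun N => \sum_(j < N) S j - \sum_(n < N) \sum_(j < n.+1) A j n).
Proof.
move=> A0 Asmall AS eps eps0; have eps2 : 0 < eps / 2 by lra.
have [N HN] := Asmall _ eps2; exists N => M le_NM.
have -> : \sum_(n < M) \sum_(j < n.+1) A j n = \sum_(j < M) \sum_(n < M) A j n.
  rewrite exchange_big /=; apply: eq_bigr => n _.
  rewrite (big_ord_widen M (fun j => A j n) (ltn_ord n)) big_mkcond /=.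
  by apply: eq_bigr => j _; case: ltnP => // /A0 ->.
rewrite -sumrB; apply: le_lt_trans (_ : eps / 2 < _); last lra.
apply: vabs_sum_le => [|j _]; first lra.
apply: series_to_tail => //; first lra.
by move=> n le_Mn; apply: HN; apply: leq_trans le_Mn.
Qed.

Lemma series_exchange_to (A : nat -> nat -> k) (S : nat -> k) l :
  (forall j n, (n < j)%N -> A j n = 0) ->
  (forall eps, 0 < eps -> exists N, forall n, (N <= n)%N -> forall j, v (A j n) <= eps) ->
  (forall j, series_to v (A j) (S j)) ->
  series_to v S l <-> series_to v (fun n => \sum_(j < n.+1) A j n) l.
Proof.
move=> A0 Asmall AS; have D0 := series_exchange A0 Asmall AS; split=> Sl.
  by apply: eq_tend0 (tend0D Sl (tend0Z (- 1) D0)) _ => n; ring.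
by apply: eq_tend0 (tend0D Sl D0) _ => n; ring.
Qed.

Definition hassum c x l := series_to v (fun n => c n * x ^+ n) l.

Lemma hassum_mul c e x l l' : hassum c x l -> hassum e x l' -> hassum (c * e) x (l * l').
Proof.
move=> cl el; have c0 := series_to_tend0 cl; have e0 := series_to_tend0 el.
have [B1 [B10 cB]] := tend0_bounded c0; have [B2 [B20 eB]] := tend0_bounded e0.
pose A i n := c i * x ^+ i * (if (i <= n)%N then e (n - i)%N * x ^+ (n - i) else 0).
pose S i := c i * x ^+ i * l'.
have AS i : series_to v (A i) (S i).
  apply: series_toZ; exact: (series_shift i el).
have A0 j n : (n < j)%N -> A j n = 0 by move=> lt_nj; rewrite /A leqNgt lt_nj mulr0.
have Asmall eps : 0 < eps ->
    exists N, forall n, (N <= n)%N -> forall j, v (A j n) <= eps.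
  move=> eps0; have b1 : 0 < B1 + 1 by lra. have b2 : 0 < B2 + 1 by lra.
  have [N1 H1] := c0 _ (divr_gt0 eps0 b2); have [N2 H2] := e0 _ (divr_gt0 eps0 b1).
  (* Either i >= N1 or n - i >= N2, so one factor is small while the other stays bounded. The added
     1 in [B1 + 1] and [B2 + 1] avoids a division by zero. *)
  exists (N1 + N2)%N => n le_n i; rewrite /A vM.
  case: ifP => [le_in|_]; last by rewrite vabs0 mulr0 ltW.
  case: (leqP N1 i) => [/H1|lt_i].
    rewrite ltr_pdivlMr// => /ltW H; apply: le_trans H.
    by apply: ler_wpM2l => //; apply: le_trans (eB _) _; rewrite lerDl.
  have /H2 : (N2 <= n - i)%N by lia.
  rewrite ltr_pdivlMr// mulrC => /ltW H; apply: le_trans H.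
  by apply: ler_wpM2r => //; apply: le_trans (cB _) _; rewrite lerDl.
have Sl : series_to v S (l * l').
  by rewrite mulrC; apply: eq_series_to (series_toZ l' cl) _ => n; rewrite /S mulrC.
apply: eq_series_to ((series_exchange_to _ A0 Asmall AS).1 Sl) _ => n.
rewrite psmul_sum mulr_suml; apply: eq_bigr => i _.
have le_in : (i <= n)%N by rewrite -ltnS.
by rewrite /A le_in -[X in _ * x ^+ X = _](subnKC le_in) exprD; ring.
Qed.

Lemma hassumD c e x l l' : hassum c x l -> hassum e x l' -> hassum (c + e) x (l + l').
Proof.
by move=> cl el; apply: eq_series_to (series_toD cl el) _ => n; rewrite psaddE mulrDl.
Qed.

Lemma hassum_le c x l B : 0 <= B -> hassum c x l ->
  (forall n, v (c n * x ^+ n) <= B) -> v l <= B.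
Proof. exact: series_le. Qed.

Lemma hassumC a x : hassum (psC a) x a.
Proof.
rewrite {2}(_ : a = \sum_(i < 1) psC a i * x ^+ i); last by rewrite big_ord1 mulr1.
by apply: series_to_fin => -[|n]//; rewrite mul0r.
Qed.

Lemma hassumX m x : hassum (psX k m) x (x ^+ m).
Proof.
rewrite (_ : x ^+ m = \sum_(i < m.+1) psX k m i * x ^+ i).
  apply: series_to_fin => n lt_mn; rewrite /psX; case: eqP => [nm|]; last by rewrite mul0r.
  by rewrite nm ltnn in lt_mn.
rewrite big_ord_recr /= /psX eqxx mul1r big1 ?add0r// => i _.
by rewrite ltn_eqF ?mul0r.
Qed.

Lemma hassum_exp c x l m : hassum c x l -> hassum (c ^+ m) x (l ^+ m).
Proof.
move=> cl; elim: m => [|m IHm]; last by rewrite !exprS; apply: hassum_mul.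
by rewrite !expr0; apply: hassumX 0 x.
Qed.

Lemma hassum_pseval c x l : hassum c x l -> pseval v c x = l.
Proof. exact: sumkE. Qed.

(** The archimedean threshold is available for powers of 2, whence the cap [2^-1] on the ratio; the
    factor [2^-1] in the radii below comes from here. *)
Lemma geom_tend0 B (q : R) : 0 <= q -> q <= 2^-1 ->
  forall eps, 0 < eps -> exists N, forall n, (N <= n)%N -> B * q ^+ n < eps.
Proof.
move=> q0 q1 eps eps0; exists (Num.bound (`|B| / eps)) => n /upper_nthrootP.
rewrite ltr_pdivrMr// => H; apply: le_lt_trans (_ : `|B| * (2 ^+ n)^-1 < _).
  apply: le_trans (_ : `|B| * q ^+ n <= _).
    by apply: ler_wpM2r; rewrite ?exprn_ge0// ler_norm.
  apply: ler_wpM2l => //; rewrite -exprVn.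
  by apply: lerXn2r; rewrite ?nnegrE ?invr_ge0.
by rewrite ltr_pdivrMr ?exprn_gt0// mulrC.
Qed.

(** * Germs at 0 of analytic functions *)

(* Geometrically bounded coefficients: positive radius of convergence. *)
Definition gb c := exists K : R, 1 <= K /\ forall n, v (c n) <= K ^+ n.+1.

Lemma gb_le K K' c : 1 <= K -> K <= K' -> (forall n, v (c n) <= K ^+ n.+1) ->
  forall n, v (c n) <= K' ^+ n.+1.
Proof.
move=> K1 KK' H n; apply: le_trans (H n) _.
by apply: lerXn2r => //; rewrite nnegrE; lra.
Qed.

(** Constant and ratio are merged into K = 1 + |B| + q, which dominates both; the exponent [n.+1] in
    [gb] leaves one factor K for the constant. *)
Lemma gb_intro B (q : R) c : 0 <= q -> (forall n, v (c n) <= B * q ^+ n) -> gb c.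
Proof.
move=> q0 H; pose K := 1 + `|B| + q; have nB := normr_ge0 B.
exists K; split=> [|n]; first by rewrite /K; lra.
apply: le_trans (H n) _; rewrite exprS.
apply: le_trans (_ : `|B| * q ^+ n <= _).
  by apply: ler_wpM2r; rewrite ?exprn_ge0// ler_norm.
apply: ler_pM; rewrite ?exprn_ge0 //; first by rewrite /K; lra.
by apply: lerXn2r; rewrite ?nnegrE /K; lra.
Qed.

Lemma gb2 c e : gb c -> gb e -> exists K, [/\ 1 <= K,
  forall n, v (c n) <= K ^+ n.+1 & forall n, v (e n) <= K ^+ n.+1].
Proof.
move=> [K1 [K11 H1]] [K2 [K21 H2]]; exists (Num.max K1 K2); split.
- by rewrite le_max K11.
- by apply: gb_le H1; rewrite // le_max lexx.
- by apply: gb_le H2; rewrite // le_max lexx orbT.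
Qed.

Lemma gbC a : gb (psC a).
Proof.
apply: (@gb_intro (v a) 1) => // n; rewrite expr1n mulr1.
by case: n => //= n; rewrite vabs0.
Qed.

Lemma gbX m : gb (psX k m).
Proof. by exists 1; split=> // n; rewrite expr1n /psX vabs_nat. Qed.

Lemma gbD c e : gb c -> gb e -> gb (c + e).
Proof.
move=> gc ge; have [K [K1 H1 H2]] := gb2 gc ge.
by exists K; split=> // n; apply: vabsD_le.
Qed.

Lemma gbM c e : gb c -> gb e -> gb (c * e).
Proof.
move=> gc ge; have [K [K1 H1 H2]] := gb2 gc ge; have K0 : 0 <= K by lra.
apply: (@gb_intro (K ^+ 2) K) => // n; rewrite -exprD psmul_sum.
apply: vabs_sum_le; first exact: exprn_ge0.
move=> i _; rewrite vM (_ : (2 + n = i.+1 + (n - i).+1)%N).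
  by rewrite exprD; apply: ler_pM.
by move: (ltn_ord i); lia.
Qed.

Lemma gb_exp c m : gb c -> gb (c ^+ m).
Proof.
move=> gc; elim: m => [|m IHm]; first by rewrite expr0; apply: gbX 0.
by rewrite exprS; apply: gbM.
Qed.

Lemma gb_sum (I : Type) (r : seq I) (F : I -> ps k) :
  (forall i, gb (F i)) -> gb (\sum_(i <- r) F i).
Proof.
move=> gF; apply: (big_ind gb) => //; first by rewrite -(rmorph0 (@psC k)); apply: gbC.
exact: gbD.
Qed.

(** For n >= 1 one has n + 1 <= 2n, so [K ^+ 2] serves as L. Unlike the bound in [gb], the bound
    [L ^+ n] is inherited unchanged by all powers of [w], which is what composition needs. *)
Lemma gb_noconst w : gb w -> w 0%N = 0 ->
  exists L : R, 1 <= L /\ forall n, v (w n) <= L ^+ n.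
Proof.
move=> [K [K1 H]] w0; exists (K ^+ 2); split; first exact: exprn_ege1.
move=> [|n]; first by rewrite w0 vabs0 expr0.
apply: le_trans (H _) _; rewrite -exprM; apply: ler_weXn2l => //; lia.
Qed.

Lemma exp_bound (L : R) w : 0 <= L -> (forall n, v (w n) <= L ^+ n) ->
  forall j n, v ((w ^+ j) n) <= L ^+ n.
Proof.
move=> L0 H; elim=> [|j IHj] n.
  rewrite expr0 psoneE; case: n => [|n]; first by rewrite vabs1 expr0.
  by rewrite vabs0 exprn_ge0.
rewrite exprS psmul_sum; apply: vabs_sum_le => [|i _]; first exact: exprn_ge0.
have le_in : (i <= n)%N by rewrite -ltnS.
by rewrite vM -[X in _ <= _ ^+ X](subnKC le_in) exprD; apply: ler_pM.
Qed.

Lemma gb_comp c w : gb c -> gb w -> w 0%N = 0 -> gb (pscomp c w).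
Proof.
move=> [K [K1 cK]] gw w0; have [L [L1 wL]] := gb_noconst gw w0.
have K0 : 0 <= K by lra. have L0 : 0 <= L by lra.
apply: (@gb_intro K (K * L)); first exact: mulr_ge0.
move=> n; rewrite pscompE; apply: vabs_sum_le => [|i _].
  by rewrite mulr_ge0 ?exprn_ge0 ?mulr_ge0.
rewrite vM exprMn mulrA -exprS; apply: ler_pM; rewrite ?exp_bound//.
by apply: le_trans (cK i) _; apply: ler_weXn2l.
Qed.

Lemma gb_hassum c : gb c ->
  exists d : R, 0 < d /\ forall x, v x < d -> exists l, hassum c x l.
Proof.
move=> [K [K1 cK]]; have K0 : 0 < K by lra.
exists (2^-1 / K); split=> [|x]; first by rewrite divr_gt0// invr_gt0.
rewrite ltr_pdivlMr// => xK; apply: series_exists.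
apply: (@tend0_le _ (fun n => K * (v x * K) ^+ n)).
  by apply: geom_tend0; [rewrite mulr_ge0// ltW|exact: ltW].
move=> n; rewrite vM vabsX exprMn mulrCA -exprS mulrC.
by apply: ler_wpM2l; rewrite ?exprn_ge0.
Qed.

(** Links formal coefficients with values near 0, so that identities known pointwise can be turned
    into identities of series. *)
Definition germ c (g : k -> k) :=
  gb c /\ exists d : R, 0 < d /\ forall x, v x < d -> hassum c x (g x).

Lemma germC a : germ (psC a) (fun=> a).
Proof.
by split; [exact: gbC|exists 1; split=> // x _; exact: hassumC].
Qed.

Lemma germX : germ (psX k 1) (fun x => x).
Proof.
by split; [exact: gbX|exists 1; split=> // x _; exact: (hassumX 1)].
Qed.

Lemma germD c e g h : germ c g -> germ e h -> germ (c + e) (fun x => g x + h x).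
Proof.
move=> [gc [d1 [d10 H1]]] [ge [d2 [d20 H2]]]; split; first exact: gbD.
exists (Num.min d1 d2); split=> [|x]; rewrite lt_min ?d10// => /andP[x1 x2].
by apply: hassumD; [apply: H1|apply: H2].
Qed.

Lemma germM c e g h : germ c g -> germ e h -> germ (c * e) (fun x => g x * h x).
Proof.
move=> [gc [d1 [d10 H1]]] [ge [d2 [d20 H2]]]; split; first exact: gbM.
exists (Num.min d1 d2); split=> [|x]; rewrite lt_min ?d10// => /andP[x1 x2].
by apply: hassum_mul; [apply: H1|apply: H2].
Qed.

Lemma germ_exp c g m : germ c g -> germ (c ^+ m) (fun x => g x ^+ m).
Proof.
move=> [gc [d [d0 H]]]; split; first exact: gb_exp.
by exists d; split=> // x xd; apply/hassum_exp/H.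
Qed.

Lemma germ_sum (I : Type) (r : seq I) (F : I -> ps k) (g : I -> k -> k) :
  (forall i, germ (F i) (g i)) -> germ (\sum_(i <- r) F i) (fun x => \sum_(i <- r) g i x).
Proof.
move=> Fg; elim: r => [|i r IHr].
  rewrite big_nil; have := germC 0; rewrite (rmorph0 (@psC k)) => -[H [d [d0 Hd]]].
  by split=> //; exists d; split=> // x /Hd; rewrite big_nil.
rewrite big_cons; have [H [d [d0 Hd]]] := germD (Fg i) IHr.
by split=> //; exists d; split=> // x /Hd; rewrite big_cons.
Qed.

Lemma germ_comp c w g h : germ c g -> germ w h -> w 0%N = 0 ->
  germ (pscomp c w) (fun x => g (h x)).
Proof.
move=> [gc [d1 [d10 H1]]] [gw [d2 [d20 H2]]] w0; split; first exact: gb_comp.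
have [K [K1 cK]] := gc; have [L [L1 wL]] := gb_noconst gw w0.
have K0 : 0 < K by lra. have L0 : 0 < L by lra. have L0' := ltW L0.
(* Below d2 the series of [h] converges; below d1 / L its value, at most v(x) L, lies where [g] is
   summed; the last bound makes the double array decay like K (K L v(x))^n. *)
exists (Num.min d2 (Num.min (d1 / L) (2^-1 / (K * L)))).
split=> [|x]; rewrite !lt_min.
  by rewrite d20 !divr_gt0 ?mulr_gt0// invr_gt0.
case/and3P=> x2; rewrite !ltr_pdivlMr ?mulr_gt0// => x1 xKL.
have wx := H2 _ x2.
have KL1 : 1 <= K * L by apply: mulr_ege1.
have xL1 : v x * L <= 1.
  apply: le_trans (_ : v x * (K * L) <= 1); last lra.
  by rewrite mulrA ler_wpM2r// ler_peMr.
have hx : v (h x) < d1.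
  apply: le_lt_trans x1; apply: hassum_le wx _ => [|n]; first exact: mulr_ge0.
  rewrite vM vabsX; case: n => [|n]; first by rewrite w0 vabs0 mul0r mulr_ge0.
  apply: le_trans (_ : (v x * L) ^+ n.+1 <= _).
    by rewrite exprMn mulrC ler_wpM2l ?exprn_ge0.
  by rewrite exprS ler_piMr ?mulr_ge0// exprn_ile1 ?mulr_ge0.
have ch := H1 _ hx.
pose A j n := c j * ((w ^+ j) n * x ^+ n).
apply: (eq_series_to (w := fun n => \sum_(j < n.+1) A j n)).
  apply/(@series_exchange_to A (fun j => c j * h x ^+ j)) => //.
  - by move=> j n lt_nj; rewrite /A pow_coef_small// mul0r mulr0.
  - move=> eps eps0.
    have q0 : 0 <= v x * (K * L) by rewrite !mulr_ge0// ltW.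
    have [N HN] := geom_tend0 K q0 (ltW xKL) eps0.
    exists N => n le_Nn j; case: (ltnP n j) => [lt_nj|le_jn].
      by rewrite /A pow_coef_small// mul0r mulr0 vabs0 ltW.
    apply: le_trans (ltW (HN _ le_Nn)).
    have -> : K * (v x * (K * L)) ^+ n = K ^+ n.+1 * L ^+ n * v x ^+ n.
      by rewrite !exprMn exprS; ring.
    rewrite /A !vM vabsX mulrA; apply: ler_wpM2r; first exact: exprn_ge0.
    apply: ler_pM => //; last exact: exp_bound.
    by apply: le_trans (cK j) _; apply: ler_weXn2l.
  - by move=> j; apply: series_toZ; apply: hassum_exp.
by move=> n; rewrite pscompE mulr_suml; apply: eq_bigr => i _; rewrite /A mulrA.
Qed.

(** * Bounds for finite families, inverse series and inverse matrices *)

Lemma fin_bounds (A : finType) (Q : A -> R -> Prop) :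
  (forall i B B', Q i B -> B <= B' -> Q i B') -> (forall i, exists B, Q i B) ->
  exists B, forall i, Q i B.
Proof.
move=> Qmono /choice[B QB]; exists (\sum_i `|B i|) => i; apply: Qmono (QB i) _.
by rewrite (bigD1 i)//= (le_trans (ler_norm _))// lerDl sumr_ge0.
Qed.

Lemma gb_fin (A : finType) (F : A -> ps k) : (forall i, gb (F i)) ->
  exists K : R, 1 <= K /\ forall i n, v (F i n) <= K ^+ n.+1.
Proof.
move=> gF; pose Q i (B : R) := 1 <= B /\ forall n, v (F i n) <= B ^+ n.+1.
have [|//|B QB] := @fin_bounds A Q.
  move=> i B B' [B1 QB] BB'; split; first exact: le_trans BB'.
  exact: gb_le QB.
exists (Num.max 1 B); split=> [|i n]; first by rewrite le_max lexx.
by have [B1 FB] := QB i; rewrite max_r.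
Qed.

Lemma conv_gb_fin (A : finType) (a : k) (F : A -> ps k) : (forall i, gb (F i)) ->
  exists rho : R, 0 < rho /\ forall i, conv_on v false a rho (F i).
Proof.
(* A radius is recorded by its inverse, so that enlarging the number weakens the claim, as
   [fin_bounds] requires. *)
move=> gF; have [|i|B QB] := @fin_bounds A
  (fun i B => 0 < B /\ forall x, v x < B^-1 -> exists l, hassum (F i) x l).
- move=> i B B' [B0 QB] BB'; split; first exact: lt_le_trans BB'.
  move=> x xB'; apply: QB; apply: lt_le_trans xB' _.
  by rewrite lef_pV2 ?posrE// (lt_le_trans B0).
- have [d [d0 Hd]] := gb_hassum (gF i); exists d^-1; rewrite invr_gt0.
  by split=> // x; rewrite invrK; apply: Hd.
exists (Num.max 1 B)^-1; split; first by rewrite invr_gt0 lt_max ltr01.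
move=> i x xB; have [B0 HB] := QB i; apply: HB.
apply: lt_le_trans xB _; rewrite lef_pV2 ?posrE ?lt_max ?ltr01//.
by rewrite le_max lexx orbT.
Qed.

(** For n >= 2, comparing coefficients expresses w_n x_1^n as minus the sum over j < n of w_j times
    coefficient n of x^j. With La = v(x_1), the bound v(x_n) <= La K^(n-1) gives La^j K^(n-j) for
    the coefficients of x^j, and induction yields v(w_n) La^n <= K^(n-1). The inequalities are
    multiplied by powers of K to avoid subtraction in exponents. *)
Lemma gb_pscompinv (w x : ps k) : w 0%N = 0 -> x 0%N = 0 -> gb x -> pscomp w x = psX k 1 -> gb w.
Proof.
move=> w0 x0 [K0 [K01 xK0]] wx; have wx1 := pscomp_inv_coef1 w0 wx.
have x1 : x 1%N != 0.
  by apply/eqP => x1; move/eqP: wx1; rewrite x1 mulr0 eq_sym oner_eq0.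
pose La := v (x 1%N); have La0 : 0 < La by rewrite vabs_gt0.
pose M := Num.max 1 La^-1; have M1 : 1 <= M by rewrite le_max lexx.
have LaM : 1 <= La * M.
  by rewrite mulrC -ler_pdivrMr// mul1r le_max lexx orbT.
(* For n >= 2 one has n + 1 <= 3 (n - 1), so [K0 ^+ 3] absorbs the bound on [x n], while M >= 1 / La
   compensates the factor La. *)
pose K := K0 ^+ 3 * M; have K1 : 1 <= K by rewrite mulr_ege1// exprn_ege1.
have Kgt0 : 0 < K by lra.
have La0' := ltW La0; have Kge0 := ltW Kgt0.
have K00 : 0 <= K0 by lra.
have xK n : v (x n) * K <= La * K ^+ n.
  case: n => [|[|n]]; first by rewrite x0 vabs0 mul0r mulr_ge0// ?exprn_ge0 ltW.
    by rewrite expr1.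
  rewrite exprSr mulrA; apply: ler_wpM2r; first exact: ltW.
  apply: le_trans (xK0 _) _; rewrite /K exprMn mulrCA -exprM.
  rewrite -[leLHS]mulr1; apply: ler_pM; rewrite ?exprn_ge0//.
    by apply: ler_weXn2l => //; rewrite mulnS -[n.+3]/(3 + n)%N leq_add2l leq_pmull.
  rewrite exprS mulrA; apply: mulr_ege1 => //; exact: exprn_ege1.
clearbody K.
have xjK j n : v ((x ^+ j) n) * K ^+ j <= La ^+ j * K ^+ n.
  elim: j n => [|j IHj] n.
    rewrite !expr0 mulr1 mul1r; case: n => [|n]; first by rewrite psoneE vabs1 expr0.
    by rewrite psoneE vabs0 exprn_ge0// ltW.
  rewrite exprS psmul_sum -ler_pdivlMr ?exprn_gt0//.
  apply: vabs_sum_le => [|i _]; first by rewrite divr_ge0 ?mulr_ge0 ?exprn_ge0// ltW.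
  rewrite ler_pdivlMr ?exprn_gt0// vM !exprS mulrACA.
  have le_in : (i <= n)%N by rewrite -ltnS.
  rewrite -[X in _ <= _ * K ^+ X](subnKC le_in) exprD [leRHS]mulrACA.
  by apply: ler_pM => //; rewrite mulr_ge0 ?exprn_ge0// ltW.
have wK n : v (w n) * La ^+ n * K <= K ^+ n.
  elim/ltn_ind: n => -[|[|n]] IHn.
  - by rewrite w0 vabs0 !mul0r expr0 ler01.
  - by rewrite !expr1 -vM wx1 vabs1 mul1r.
  have := congr1 (fun c : ps k => c n.+2) wx.
  rewrite pscompE big_ord_recr /= pow_coef_diag// /psX /= => /eqP.
  rewrite addrC addr_eq0 => /eqP /(congr1 v); rewrite vabsN vM vabsX => ->.
  rewrite -ler_pdivlMr//; apply: vabs_sum_le => [|j _].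
    by rewrite divr_ge0 ?exprn_ge0// ltW.
  rewrite ler_pdivlMr// vM; have c0 : 0 < La ^+ j * K ^+ j by rewrite mulr_gt0 ?exprn_gt0.
  rewrite -(ler_pM2l c0).
  have -> : La ^+ j * K ^+ j * (v (w j) * v ((x ^+ j) n.+2) * K) =
    (v (w j) * La ^+ j * K) * (v ((x ^+ j) n.+2) * K ^+ j) by ring.
  have -> : La ^+ j * K ^+ j * K ^+ n.+2 = K ^+ j * (La ^+ j * K ^+ n.+2) by ring.
  have Laj : 0 <= La ^+ j by exact: exprn_ge0.
  have Kj : 0 <= K ^+ j by exact: exprn_ge0.
  apply: ler_pM (IHn j (ltn_ord j)) (xjK j n.+2); first by rewrite mulr_ge0// mulr_ge0.
  exact: mulr_ge0.
apply: (@gb_intro K^-1 (K / La)); first by rewrite divr_ge0 ?ltW.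
move=> n; have := wK n; rewrite -mulrA -ler_pdivlMr ?mulr_gt0 ?exprn_gt0//.
by rewrite exprMn exprVn invfM mulrA mulrC.
Qed.

(** In degree n + 1 the relation U V = 1 reads U_0 V_(n+1) = - sum_q U_(q+1) V_(n-q), and V_0
    inverts U_0. The factor M = B0 K is chosen so that K^(q+2) B0 = K^(q+1) M <= (K M)^(q+1), which
    closes the induction. *)
Lemma gb_matinv d (U V : 'I_d -> 'I_d -> ps k) :
  (forall i j, gb (U i j)) ->
  (forall i i', \sum_j U i j * V j i' = (i == i')%:R) ->
  (forall j j', \sum_i V j i * U i j' = (j == j')%:R) ->
  forall j i, gb (V j i).
Proof.
move=> gU UV VU.
have [K [K1 UK]] := @gb_fin ('I_d * 'I_d)%type (fun ij => U ij.1 ij.2) (fun=> gU _ _).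
have [|ij|B V0B] := @fin_bounds ('I_d * 'I_d)%type
    (fun ij B => v (V ij.1 ij.2 0%N) <= B).
- by move=> ij B B' H; apply: le_trans.
- by exists (v (V ij.1 ij.2 0%N)).
have K0 : 0 < K by lra.
pose B0 := Num.max 1 B; have B01 : 1 <= B0 by rewrite le_max lexx.
have V0B0 j i : v (V j i 0%N) <= B0.
  by apply: le_trans (V0B (j, i)) _; rewrite le_max lexx orbT.
pose M := B0 * K; have M1 : 1 <= M by rewrite mulr_ege1.
have M0 : 0 < M by lra. have B00 : 0 < B0 by lra.
suff VB n j i : v (V j i n) <= B0 * (K * M) ^+ n.
  by move=> j i; apply: (@gb_intro B0 (K * M)) => //; rewrite mulr_ge0 ?ltW.
elim/ltn_ind: n j i => -[|n] IHn j i; first by rewrite expr0 mulr1.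
have natps (b : bool) m : (b%:R : ps k) m = (b && (m == 0%N))%:R by case: b.
have VU0 j1 j2 : \sum_i1 V j1 i1 0%N * U i1 j2 0%N = (j1 == j2)%:R.
  have := congr1 (fun c : ps k => c 0%N) (VU j1 j2).
  rewrite ps_sumE natps andbT => <-; apply: eq_bigr => i1 _.
  by rewrite psmul_coef0.
have E : V j i n.+1 = - \sum_i' V j i' 0%N *
    \sum_j' \sum_(q < n.+1) U i' j' q.+1 * V j' i (n - q)%N.
  have S0 i' : \sum_j' U i' j' 0%N * V j' i n.+1 =
      - \sum_j' \sum_(q < n.+1) U i' j' q.+1 * V j' i (n - q)%N.
    apply/eqP; rewrite -addr_eq0 -big_split /=.
    have := congr1 (fun c : ps k => c n.+1) (UV i' i).
    rewrite ps_sumE natps andbF => H0; apply/eqP; apply: etrans H0; apply: eq_bigr => j' _.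
    by rewrite psmul_sum [RHS]big_ord_recl subn0.
  have -> : V j i n.+1 = \sum_j' (\sum_i' V j i' 0%N * U i' j' 0%N) * V j' i n.+1.
    rewrite (eq_bigr (fun j' => (j == j')%:R * V j' i n.+1)).
      rewrite (bigD1 j)//= big1 => [|j' /negPf neq]; last by rewrite eq_sym neq mul0r.
      by rewrite eqxx mul1r addr0.
    by move=> j' _; rewrite VU0.
  rewrite (eq_bigr _ (fun j' _ => mulr_suml _ _ _ _)) exchange_big /= -sumrN.
  apply: eq_bigr => i' _; rewrite -mulrN -S0 mulr_sumr.
  by apply: eq_bigr => j' _; rewrite mulrA.
have R0 : 0 <= B0 * (K * M) ^+ n.+1 by rewrite mulr_ge0 ?exprn_ge0 ?mulr_ge0 ?ltW.
rewrite E vabsN; apply: vabs_sum_le => // i' _; rewrite mulr_sumr.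
apply: vabs_sum_le => // j' _; rewrite mulr_sumr.
apply: vabs_sum_le => // q _; rewrite !vM.
have le_qn : (q <= n)%N by rewrite -ltnS.
apply: le_trans (_ : B0 * (K ^+ q.+2 * (B0 * (K * M) ^+ (n - q))) <= _).
  apply: ler_pM; rewrite ?mulr_ge0//; apply: ler_pM => //.
    exact: (UK (i', j')).
  by apply: IHn; rewrite ltnS leq_subr.
rewrite -[X in _ <= _ * _ ^+ X.+1](subnKC le_qn) -addSn exprD.
rewrite ler_pM2l// mulrA ler_pM2r ?exprn_gt0 ?mulr_gt0//.
have -> : K ^+ q.+2 * B0 = K ^+ q.+1 * M by rewrite /M (exprS K q.+1); ring.
by rewrite (exprMn _ K M) ler_pM2l ?exprn_gt0// ler_eXnr.
Qed.

(** * Nonzero elements of small absolute value: series are determined by their values *)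

Section SmallElements.
Hypothesis small : forall d : R, 0 < d -> exists x, x != 0 /\ v x < d.

(** Convergence at a single point a + x with x nonzero bounds the terms c_n x^n, hence c_n
    geometrically with ratio 1 / v(x). *)
Lemma conv_on_gb a (rho : R) c : 0 < rho -> conv_on v false a rho c -> gb c.
Proof.
move=> rho0 cc; have [x [x0 xr]] := small rho0.
have [|l] := cc (x + a); first by rewrite /in_disc addrK.
rewrite addrK => cl; have [B [B0 HB]] := tend0_bounded (series_to_tend0 cl).
apply: (@gb_intro B (v x)^-1); first by rewrite invr_ge0.
move=> n; rewrite exprVn ler_pdivlMr ?exprn_gt0 ?vabs_gt0//.
by rewrite -vabsX -vM.
Qed.

Lemma germ_eq0 c : germ c (fun=> 0) -> c = 0.
Proof.
move=> [[K [K1 cK]] [d [d0 Hd]]]; apply: psP; elim/ltn_ind => n IHn.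
apply/eqP/negPn/negP; rewrite -vabs_gt0 => cn.
have K0 : 0 < K by lra.
(* The sum at [x] is 0; the terms beyond index [n] are at most K^(n+2) v(x)^(n+1) because K v(x) <
   1; the third constraint makes v(c_n x^n) exceed that bound. *)
have [x [x0]] : exists x, x != 0 /\
    v x < Num.min d (Num.min K^-1 (v (c n) / K ^+ n.+2)).
  by apply: small; rewrite !lt_min d0 invr_gt0 K0 divr_gt0 ?exprn_gt0.
rewrite !lt_min => /and3P[xd xK xc]; have vx : 0 < v x by rewrite vabs_gt0.
have B0 : 0 <= K ^+ n.+2 * v x ^+ n.+1 by rewrite mulr_ge0 ?exprn_ge0// ltW.
have := series_to_tail B0 (Hd _ xd) (N := n.+1).
rewrite big_ord_recr big1 /= => [|i _]; last by rewrite IHn ?mul0r.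
rewrite !add0r vabsN vM vabsX => H.
have /H : forall m, (n.+1 <= m)%N -> v (c m * x ^+ m) <= K ^+ n.+2 * v x ^+ n.+1.
  move=> m le_nm; rewrite vM vabsX.
  apply: le_trans (_ : K ^+ m.+1 * v x ^+ m <= _).
    by apply: ler_wpM2r (cK m); rewrite exprn_ge0.
  rewrite -(subnKC le_nm) -addSn !exprD mulrACA -exprMn ler_piMr// exprn_ile1 ?mulr_ge0 ?ltW//.
  by rewrite -ltr_pdivlMl ?mulr1.
rewrite (exprS (v x) n) mulrA ler_pM2r ?exprn_gt0// leNgt => /negP; apply.
by rewrite mulrC -ltr_pdivlMr ?exprn_gt0.
Qed.

Lemma germ_uniq c e g h : germ c g -> germ e h ->
  (exists d : R, 0 < d /\ forall x, v x < d -> g x = h x) -> c = e.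
Proof.
move=> cg eh [d1 [d10 gh]]; apply/eqP; rewrite -subr_eq0 -mulN1r; apply/eqP/germ_eq0.
have [H [d2 [d20 Hd]]] := germD cg (germM (germC (-1)) eh).
have E : psC (- 1) = - 1 :> ps k by rewrite rmorphN rmorph1.
rewrite E in H Hd; split=> //; exists (Num.min d1 d2).
split=> [|x]; rewrite lt_min ?d10// => /andP[x1 x2].
by have := Hd _ x2; rewrite /= gh// [X in hassum _ _ (_ + X)]mulN1r subrr.
Qed.

(** * Analytic functions on the unit disc and their expansions *)

Section Disc.
Variable cl : bool.

Lemma in_disc_le x y : v x <= v y -> in_disc v cl 0 1 y -> in_disc v cl 0 1 x.
Proof.
by rewrite /in_disc !subr0 => xy; case: cl => H; [apply: le_trans H|apply: le_lt_trans H].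
Qed.

(** Estimates at [a] are made at a nonzero point of the same disc, so that dividing by its powers is
    possible even when [a] is 0. *)
Lemma disc_dominate a : in_disc v cl 0 1 a ->
  exists x, [/\ x != 0, v a <= v x & in_disc v cl 0 1 x].
Proof.
move=> aD; have [a0|a0] := eqVneq a 0; last by exists a.
have [x [x0 x1]] := small ltr01; exists x; split=> //; first by rewrite a0 vabs0.
by rewrite /in_disc subr0; case: cl => //; apply: ltW.
Qed.

Lemma analytic_hassum c x : analytic v cl c -> in_disc v cl 0 1 x ->
  hassum c x (pseval v c x).
Proof.
move=> ac /ac[l]; rewrite subr0 => cl'; by rewrite (hassum_pseval cl').
Qed.

Lemma expand0 c a : expand v c a 0%N = pseval v c a.
Proof.
by congr sumk; apply: funext => n; rewrite addn0 bin0 mulr1.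
Qed.

Lemma expand_term_le c a x m n : v a <= v x ->
  v (c (n + m)%N * ('C(n + m, m))%:R * a ^+ n) <= v (c (n + m)%N * x ^+ n).
Proof.
move=> ax; rewrite !vM !vabsX; apply: ler_pM; rewrite ?mulr_ge0 ?exprn_ge0//.
  by rewrite ler_piMr// vabs_nat.
by apply: lerXn2r; rewrite ?nnegrE.
Qed.

Lemma expand_series c a m : analytic v cl c -> in_disc v cl 0 1 a ->
  series_to v (fun n => c (n + m)%N * ('C(n + m, m))%:R * a ^+ n) (expand v c a m).
Proof.
move=> ac aD; have [x [x0 ax xD]] := disc_dominate aD.
have [|l Hl] := @series_exists (fun n => c (n + m)%N * ('C(n + m, m))%:R * a ^+ n).
- move=> eps eps0.
  have [N HN] := tend0Z (x ^+ m)^-1 (series_to_tend0 (analytic_hassum ac xD)) eps0.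
  exists N => n le_Nn; apply: le_lt_trans (expand_term_le _ _ _ ax) _.
  have := HN _ (leq_trans le_Nn (leq_addr m n)).
  by rewrite exprD mulrC !mulrA mulfK ?expf_neq0.
by rewrite /expand (sumkE Hl).
Qed.

(** The array c_n C(n,m) x^m a^(n-m), summed over n first, gives the expansion at [a]; summed over m
    first, the binomial formula for c_n (a + x)^n. Its entries are at most v(c_n x0^n), which tends
    to 0 uniformly in m. *)
Lemma germ_expand c a : analytic v cl c -> in_disc v cl 0 1 a ->
  germ (expand v c a) (fun x => pseval v c (a + x)).
Proof.
move=> ac aD; have [x0 [x00 ax x0D]] := disc_dominate aD.
have vx0 : 0 < v x0 by rewrite vabs_gt0.
have c0 := series_to_tend0 (analytic_hassum ac x0D).
split.
  have [B [B0 HB]] := tend0_bounded c0.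
  apply: (@gb_intro B (v x0)^-1) => [|m]; first by rewrite invr_ge0.
  have R0 : 0 <= B * (v x0)^-1 ^+ m by rewrite mulr_ge0 ?exprn_ge0 ?invr_ge0.
  apply: series_le (expand_series m ac aD) _ => // n.
  apply: le_trans (expand_term_le _ _ _ ax) _.
  rewrite exprVn ler_pdivlMr ?exprn_gt0// -vabsX -vM -mulrA -exprD.
  exact: HB.
exists (v x0); split=> // x /ltW xx0.
have axD : in_disc v cl 0 1 (a + x) by apply: in_disc_le x0D; apply: vabsD_le.
pose A m n := x ^+ m * (if (m <= n)%N then
  c (n - m + m)%N * ('C(n - m + m, m))%:R * a ^+ (n - m) else 0).
apply: (eq_series_to (w := fun m => x ^+ m * expand v c a m)); last by move=> n; rewrite mulrC.
apply/(@series_exchange_to A).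
- by move=> j n lt_nj; rewrite /A leqNgt lt_nj mulr0.
- move=> eps eps0; have [N HN] := c0 _ eps0; exists N => n /HN /ltW H j.
  rewrite /A; case: leqP => [le_jn|_]; last by rewrite mulr0 vabs0 ltW.
  apply: le_trans H; rewrite vM mulrC.
  apply: le_trans (_ : v (c (n - j + j)%N * x0 ^+ (n - j)) * v (x0 ^+ j) <= _).
    apply: ler_pM => //; first exact: expand_term_le.
    by rewrite !vabsX; apply: lerXn2r; rewrite ?nnegrE.
  by rewrite -vM -mulrA -exprD subnK.
- move=> j; apply: series_toZ; exact: (series_shift j (expand_series j ac aD)).
apply: eq_series_to (analytic_hassum ac axD) _ => n.
rewrite exprDn mulr_sumr; apply: eq_bigr => j _.
have le_jn : (j <= n)%N by rewrite -ltnS.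
by rewrite /A le_jn subnK// -mulr_natr; ring.
Qed.

Lemma analytic_deriv c : analytic v cl c -> analytic v cl (psderiv c).
Proof.
move=> ac x xD; have [x0 [x00 xx0 x0D]] := disc_dominate xD.
apply: series_exists => eps eps0; rewrite subr0.
have [N HN] := tend0Z x0^-1 (series_to_tend0 (analytic_hassum ac x0D)) eps0.
exists N => n le_Nn; apply: le_lt_trans (HN _ (leqW le_Nn)).
rewrite exprS mulrCA mulKf// !vM !vabsX; apply: ler_pM; rewrite ?mulr_ge0 ?exprn_ge0//.
  by rewrite ler_piMr// vabs_nat.
by apply: lerXn2r; rewrite ?nnegrE.
Qed.

Lemma expand_deriv c a : analytic v cl c -> in_disc v cl 0 1 a ->
  expand v (psderiv c) a = psderiv (expand v c a).
Proof.
move=> ac aD; apply: psP => m; rewrite /psderiv mulrC; apply: sumkE.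
apply: eq_series_to (series_toZ m.+1%:R (expand_series m.+1 ac aD)) _ => n.
rewrite addnS; have := congr1 (fun i => i%:R : k) (mul_bin_diag (n + m).+1 m).
by rewrite /= !natrM -/(psderiv c) /psderiv => E; rewrite -(mulrA (c _)) E; ring.
Qed.

Lemma in_disc_near a x : in_disc v cl 0 1 a -> v x < 1 -> in_disc v cl 0 1 (a + x).
Proof.
rewrite /in_disc !subr0; case: cl => a1 x1; last exact: vabsD_lt.
by apply: vabsD_le => //; apply: ltW.
Qed.

Lemma germ_ext c g h : (forall x, g x = h x) -> germ c g -> germ c h.
Proof.
by move=> gh [gc [d [d0 H]]]; split=> //; exists d; split=> // x /H; rewrite gh.
Qed.

(** Trades the common radius of convergence for [gb], and the coefficientwise equation for one in
    the ring of series. *)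
Lemma horizontalP (A : finType) (G : A -> A -> ps k) a (Z : A -> ps k) :
  horizontal v G a Z <-> (forall l : A, gb (Z l)) /\
    (forall l : A, psderiv (Z l) + \sum_l' expand v (G l l') a * Z l' = 0).
Proof.
split=> [[[rho [rho0 cZ]] ode]|[gZ ode]]; split.
- by move=> l; apply: conv_on_gb rho0 (cZ l).
- by move=> l; apply: psP => n; rewrite psaddE ps_sumE; apply: ode.
- exact: conv_gb_fin.
- move=> l n; have := congr1 (fun c : ps k => c n) (ode l).
  by rewrite psaddE ps_sumE.
Qed.

(** * Pullback along s = f(t) near a preimage of b *)

Section Pullback.
Variables (f : ps k) (a b : k).
Hypotheses (fA : analytic v cl f) (aD : in_disc v cl 0 1 a)
  (bD : in_disc v cl 0 1 b) (fab : pseval v f a = b).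

Definition loc_param := psnoconst (expand v f a).
Definition loc_coord := psC a + psX k 1.

Lemma loc_param0 : loc_param 0%N = 0. Proof. by []. Qed.

Lemma loc_param_deriv : psderiv loc_param = expand v (psderiv f) a.
Proof. by rewrite (expand_deriv fA aD). Qed.

Lemma loc_coord_deriv : psderiv loc_coord = 1.
Proof.
apply: psP => -[|n]; rewrite /psderiv /loc_coord psaddE /psC /psX /= ?add0r ?mul1r//.
by rewrite mul0r.
Qed.

Lemma germ_loc_param : germ loc_param (fun x => pseval v f (a + x) - b).
Proof.
rewrite /loc_param psnoconstE expand0 fab -rmorphN.
exact: germD (germ_expand fA aD) (germC _).
Qed.

Lemma germ_loc_coord : germ loc_coord (fun x => a + x).
Proof. exact: germD (germC a) germX. Qed.

Lemma germ_pullback h : analytic v cl h ->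
  germ (pscomp (expand v h b) loc_param) (fun x => pseval v h (pseval v f (a + x))).
Proof.
move=> hA; have := germ_comp (germ_expand hA bD) germ_loc_param loc_param0.
by apply: germ_ext => x; rewrite addrC subrK.
Qed.

Lemma pullback_relation n (Q : 'I_n -> ps k) : (forall m, analytic v cl (Q m)) ->
  (forall x, in_disc v cl 0 1 x ->
     \sum_(m < n) pseval v (Q m) (pseval v f x) * x ^+ m = 0) ->
  \sum_(m < n) pscomp (expand v (Q m) b) loc_param * loc_coord ^+ m = 0.
Proof.
move=> QA Q0; have g0 := germC 0; rewrite (rmorph0 (@psC k)) in g0.
apply: (germ_uniq _ g0).
  by apply: germ_sum => m; apply: germM (germ_pullback (QA m)) (germ_exp m germ_loc_coord).
by exists 1; split=> // x x1; rewrite Q0// in_disc_near.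
Qed.

Lemma loc_param_inverse (d : nat) (P : 'I_d.+1 -> ps k) (r : 'I_d -> k) (i0 : 'I_d)
    (u : ps k) :
  (forall m, analytic v cl (P m)) -> P ord_max = ps1 k ->
  (forall x, in_disc v cl 0 1 x ->
     \sum_(m < d.+1) pseval v (P m) (pseval v f x) * x ^+ m = 0) ->
  injective r -> (forall i, in_disc v cl 0 1 (r i)) -> (forall i, pseval v f (r i) = b) ->
  r i0 = a -> u 0%N = a -> \sum_(m < d.+1) expand v (P m) b * u ^+ m = 0 ->
  pscomp u loc_param = loc_coord.
Proof.
move=> PA Pmax P0 r_inj rD fr ra u0 Pu.
pose q : {poly ps k} := \poly_(m < d.+1) pscomp (expand v (P (inord m)) b) loc_param.
have qE c : q.[c] = \sum_(m < d.+1) pscomp (expand v (P m) b) loc_param * c ^+ m.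
  by rewrite horner_poly; apply: eq_bigr => m _; rewrite inord_val.
have uc0 : pscomp u loc_param 0%N = a.
  by rewrite pscompE big_ord1 expr0 mulr1.
apply: (@ps_simple_root _ q).
- rewrite qE -[RHS](pscomp0 loc_param0) -[X in _ = pscomp X _]Pu (pscomp_sum loc_param0).
  by apply: eq_bigr => m _; rewrite (pscompM loc_param0) (pscompXn loc_param0).
- by rewrite qE; apply: pullback_relation.
- by rewrite uc0 /loc_coord psaddE addr0.
rewrite uc0; set q0 := map_poly _ q.
have q0E : q0 = \poly_(m < d.+1) pseval v (P (inord m)) b.
  apply/polyP => m; rewrite coef_map !coef_poly; case: ifP => // _.
  by rewrite -[LHS]/(pscomp _ _ 0%N) pscompE big_ord1 expr0 mulr1 expand0.
have Pb : pseval v (P (inord d)) b = 1.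
  rewrite (_ : inord d = ord_max); last by apply: val_inj; rewrite /= inordK.
  by rewrite Pmax; apply/hassum_pseval/(hassumX 0).
have size_q0 : size q0 = d.+1 by rewrite q0E size_poly_eq// Pb oner_neq0.
have q0_prod : q0 = \prod_(i < d) ('X - (r i)%:P).
  rewrite (@all_roots_prod_XsubC _ q0 [seq r i | i <- enum 'I_d]).
  - rewrite big_map big_enum /= lead_coefE size_q0 q0E coef_poly ltnSn Pb.
    by rewrite scale1r.
  - by rewrite size_map size_enum_ord.
  - apply/allP => _ /mapP[i _ ->]; apply/rootP.
    rewrite q0E horner_poly -[RHS](P0 _ (rD i)) fr.
    by apply: eq_bigr => m _; rewrite inord_val.
  by rewrite uniq_rootsE map_inj_uniq ?enum_uniq.
rewrite q0_prod (bigD1 i0)//= derivM derivXsubC hornerD !hornerM hornerXsubC.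
rewrite ra subrr mul0r addr0 hornerC mul1r horner_prod.
apply/prodf_neq0 => i ne; rewrite hornerXsubC subr_eq0 -ra.
by apply/eqP => /r_inj E; rewrite E eqxx in ne.
Qed.

Lemma pullback_matrix (A : finType) (d : nat)
    (G : A -> A -> ps k) (H : A * 'I_d -> A * 'I_d -> ps k) :
  (forall l l' : A, analytic v cl (G l l')) ->
  (forall lm lm', analytic v cl (H lm lm')) ->
  (forall (l l' : A) (m' : 'I_d) x, in_disc v cl 0 1 x ->
     pseval v (psderiv f) x *
       \sum_(m < d) pseval v (H (l, m) (l', m')) (pseval v f x) * x ^+ m
     = pseval v (psadd (if l == l' then psderiv (psX k m') else ps0 k)
                       (psmul (psX k m') (G l l'))) x) ->
  forall (l l' : A) (m' : 'I_d), psderiv loc_param *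
      \sum_(m < d) pscomp (expand v (H (l, m) (l', m')) b) loc_param * loc_coord ^+ m =
    (if l == l' then loc_coord ^+ m'.-1 *+ m' else 0) +
    loc_coord ^+ m' * expand v (G l l') a.
Proof.
move=> GA HA HH l l' m'; rewrite loc_param_deriv.
(* Both cases of the Kronecker term become one monomial with coefficient [e]; for m' = 0 the
   truncated exponent [m'.-1] is harmless since [e] vanishes. *)
pose e : k := if l == l' then m'%:R else 0.
have -> : (if l == l' then loc_coord ^+ m'.-1 *+ m' else 0) = psC e * loc_coord ^+ m'.-1.
  by rewrite /e; case: eqP => _; rewrite ?rmorph0 ?mul0r// rmorph_nat mulr_natl.
apply: germ_uniq.
- apply: germM; first exact: germ_expand (analytic_deriv fA) aD.
  by apply: germ_sum => m; apply: germM (germ_pullback (HA _ _)) (germ_exp m germ_loc_coord).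
- apply: germD; first exact: germM (germC e) (germ_exp _ germ_loc_coord).
  exact: germM (germ_exp _ germ_loc_coord) (germ_expand (GA l l') aD).
exists 1; split=> // x x1; have axD := in_disc_near aD x1.
rewrite HH//; apply: hassum_pseval.
have -> : (if l == l' then psderiv (psX k m') else ps0 k) = psC e * psX k m'.-1.
  rewrite /e; case: eqP => _; last by rewrite rmorph0 mul0r.
  by rewrite psderiv_psX rmorph_nat mulr_natl.
apply: hassumD; first exact: hassum_mul (hassumC _ _) (hassumX _ _).
exact: hassum_mul (hassumX _ _) (analytic_hassum (GA l l') axD).
Qed.

End Pullback.
End Disc.
End SmallElements.
End NonArchimedeanSeries.

(** * The direct image *)

Unset Implicit Arguments.

Theorem theorem3p12
  (R : realType) (k : closedFieldType) (v : k -> R) (p : nat)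
  (cl : bool) (d r : nat)
  (f : ps k) (P : 'I_d.+1 -> ps k)
  (G : 'I_r -> 'I_r -> ps k)
  (H : 'I_r * 'I_d -> 'I_r * 'I_d -> ps k)
  (b : k) (a : 'I_d -> k) (u : 'I_d -> ps k) (V : 'I_d -> 'I_d -> ps k)
  (Y : 'I_d -> 'I_r -> 'I_r -> ps k) :
  (* k: complete non-archimedean, extending the p-adic absolute value *)
  nonarch_abs v -> complete_abs v -> prime p -> [pchar k] =i pred0 ->
  v p%:R = (p%:R)^-1 ->
  (* phi : D_t -> D_s finite etale of degree d, s = f(t) *)
  finite_etale_disc v cl f d ->
  (* P(s, X) = sum_m P m (s) X^m monic of degree d over O_s with P(f(t), t) = 0 *)
  (forall m, analytic v cl (P m)) -> P ord_max = ps1 k ->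
  (forall x, in_disc v cl 0 1 x ->
     \sum_(m < d.+1) pseval v (P m) (pseval v f x) * x ^+ m = 0) ->
  (* (M, D_t): connection matrix G in the basis e_1..e_r *)
  (forall l l', analytic v cl (G l l')) ->
  (* (M_phi, D_s): H (l,m) (l',m') = coefficient of t^m e_l in D_s(t^m' e_l') *)
  (forall lm lm', analytic v cl (H lm lm')) ->
  (forall (l l' : 'I_r) (m' : 'I_d) x, in_disc v cl 0 1 x ->
     pseval v (psderiv f) x *
       \sum_(m < d) pseval v (H (l, m) (l', m')) (pseval v f x) * x ^+ m
     = pseval v (psadd (if l == l' then psderiv (psX k m') else ps0 k)
                       (psmul (psX k m') (G l l'))) x) ->
  (* b in D_s, phi^-1(b) = {a_1, ..., a_d} *)
  in_disc v cl 0 1 b -> injective a ->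
  (forall i, in_disc v cl 0 1 (a i)) -> (forall i, pseval v f (a i) = b) ->
  (forall x, in_disc v cl 0 1 x -> pseval v f x = b -> exists i, x = a i) ->
  (* u_{a_i}(s) in k[[s-b]]: constant term a_i and P(s, u_{a_i}(s)) = 0 *)
  (forall i, u i 0%N = a i) ->
  (forall i n, \sum_(m < d.+1) psmul (expand v (P m) b) (pspow (u i) m) n = 0) ->
  (* V = U^-1, U i j = u_{a_i}^j *)
  (forall (i i' : 'I_d) n, \sum_(j < d) psmul (pspow (u i) j) (V j i') n
                  = ((i == i') && (n == 0%N))%:R) ->
  (forall (j j' : 'I_d) n, \sum_(i < d) psmul (V j i) (pspow (u i) j') n
                  = ((j == j') && (n == 0%N))%:R) ->
  (* for each i, (Y i j)_j is a basis of the horizontal elements of M at a_i *)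
  (forall i, is_basis (horizontal v G (a i)) (Y i)) ->
  (* the vectors V_r(s) w_{i,j}(s) form a basis of horizontal elements of M_phi at b;
     the (l,m)-coordinate (coefficient of t^m e_l) of V_r w_{i,j} is
     V_{m,i}(s) * (l-th component of Y_{a_i,j})(u_{a_i}(s)) *)
  is_basis (horizontal v H b)
    (fun (ij : 'I_d * 'I_r) (lm : 'I_r * 'I_d) =>
       psmul (V lm.2 ij.1) (pscomp (Y ij.1 ij.2 lm.1) (psnoconst (u ij.1)))).
Proof.
move=> Hv Hc p_pr _ vp [fA _ _ _ _] PA Pmax P0 GA HA HH bD a_inj aD fa _ u0 Pu UV VU Ybasis.
(* Powers of p serve: v(p^N) = p^(-N), and p >= 2 gives the ratio at most 1/2 required by
   [geom_tend0]. *)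
have small e : 0 < e -> exists x, x != 0 /\ v x < e.
  move=> e0; have p2 : (2 : R) <= p%:R by rewrite ler_nat prime_gt1.
  have p0 : (0 : R) < p%:R by lra.
  have pV : (p%:R)^-1 <= 2^-1 :> R by rewrite lef_pV2 ?posrE.
  have pV0 : 0 <= (p%:R)^-1 :> R by rewrite invr_ge0 ltW.
  have [N HN] := geom_tend0 1 pV0 pV e0.
  exists (p%:R ^+ N); split; last by rewrite (vabsX Hv) vp -[ltLHS]mul1r HN.
  by rewrite expf_neq0// -(nabs_eq0 Hv) vp invr_eq0 gt_eqF.
pose x i := loc_param v f (a i); pose t i := loc_coord (a i).
pose w i := psnoconst (u i).
have x0 i : x i 0%N = 0 by [].
have w0 i : w i 0%N = 0 by [].
have ux i : pscomp (u i) (x i) = t i.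
  apply: (loc_param_inverse Hv Hc small fA (aD i) bD (fa i) PA Pmax P0 a_inj aD fa
    (erefl _) (u0 i)).
  apply: psP => n; rewrite ps_sumE -[RHS](Pu i n); apply: eq_bigr => m _.
  by rewrite pspowE.
have wx i : pscomp (w i) (x i) = psX k 1.
  rewrite /w psnoconstE u0 -rmorphN pscompD// pscompC// ux /t /loc_coord rmorphN.
  by rewrite addrAC subrr add0r.
have x1 i : x i 1%N != 0.
  apply/eqP => x1; have := pscomp_inv_coef1 (w0 i) (wx i); rewrite x1 mulr0.
  by move/eqP; rewrite eq_sym oner_eq0.
have gx i : gb v (x i) by case: (germ_loc_param Hv Hc small fA (aD i) (fa i)).
have gw i : gb v (w i) by apply: gb_pscompinv (w0 i) (x0 i) (gx i) (wx i).
have gu i : gb v (u i).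
  rewrite -(subrK (psC (u i 0%N)) (u i)) -psnoconstE.
  exact: (gbD Hv (gw i) (gbC Hv _)).
have gt i : gb v (t i) by apply: (gbD Hv (gbC Hv _) (gbX Hv _)).
have t' i : psderiv (t i) = 1 by apply: loc_coord_deriv.
have natps (c : bool) n : (c%:R : ps k) n = (c && (n == 0%N))%:R by case: c.
have UV' i i' : \sum_(j < d) u i ^+ j * V j i' = (i == i')%:R.
  apply: psP => n; rewrite natps -(UV i i' n) ps_sumE; apply: eq_bigr => j _.
  by rewrite -pspowE.
have VU' (j j' : 'I_d) : \sum_(i < d) V j i * u i ^+ j' = (j == j')%:R.
  apply: psP => n; rewrite natps -(VU j j' n) ps_sumE; apply: eq_bigr => i _.
  by rewrite -pspowE.
have gV j i : gb v (V j i).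
  by apply: (gb_matinv Hv (U := fun i j => u i ^+ j)) => // i1 j1; apply: (gb_exp Hv).
have HH' i := pullback_matrix Hv Hc small fA (aD i) bD (fa i) GA HA HH.
(* [W Z] is the product of the block diagonal matrix of copies of U with [Z]; [VW] recovers [Z] from
   it. *)
pose W (Z : 'I_r * 'I_d -> ps k) i l := \sum_(m < d) u i ^+ m * Z (l, m).
have VW Z l m : Z (l, m) = \sum_(i < d) V m i * W Z i l.
  transitivity (\sum_(m' < d) (\sum_(i < d) V m i * u i ^+ m') * Z (l, m')).
    rewrite (eq_bigr (fun m' : 'I_d => (m == m')%:R * Z (l, m'))) => [|m' _]; last by rewrite VU'.
    rewrite (bigD1 m)//= eqxx mul1r big1 ?addr0// => m' /negPf.
    by rewrite eq_sym => ->; rewrite mul0r.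
  rewrite (eq_bigr _ (fun m' _ => mulr_suml _ _ _ _)) exchange_big /=.
  apply: eq_bigr => i _; rewrite mulr_sumr; apply: eq_bigr => m' _.
  by rewrite mulrA.
have Wx Z i l : pscomp (W Z i l) (x i) = \sum_(m < d) t i ^+ m * pscomp (Z (l, m)) (x i).
  rewrite pscomp_sum//; apply: eq_bigr => m _.
  by rewrite (pscompM (x0 i)) (pscompXn (x0 i)) ux.
pose E (Z : 'I_r * 'I_d -> ps k) lm :=
  psderiv (Z lm) + \sum_lm' expand v (H lm lm') b * Z lm'.
(* Valid for every [Z], horizontal or not: up to the factor f', the defect [E Z] pulls back to the
   defect of the pulled back vector at a_i. Both horizontality of the proposed vectors and spanning
   rest on it. *)
have ode Z i l : psderiv (x i) * pscomp (W (E Z) i l) (x i) =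
    psderiv (pscomp (W Z i l) (x i)) +
    \sum_l' expand v (G l l') (a i) * pscomp (W Z i l') (x i).
  rewrite Wx; apply: etrans (@direct_image_ode _ _ _ (x i) (t i)
    (fun lm lm' => expand v (H lm lm') b) (fun l l' => expand v (G l l') (a i))
    Z (x0 i) (t' i) (HH' i) l) _.
  rewrite /= -Wx.
  by congr (_ + _); apply: eq_bigr => l' _; rewrite -Wx.
pose F i j (lm : 'I_r * 'I_d) := V lm.2 i * pscomp (Y i j lm.1) (w i).
have WF i0 j i l : W (F i0 j) i l = (i == i0)%:R * pscomp (Y i0 j l) (w i0).
  rewrite -UV' mulr_suml; apply: eq_bigr => m _; by rewrite mulrA.
have Yx i j l : pscomp (pscomp (Y i j l) (w i)) (x i) = Y i j l.
  exact: pscompK (w0 i) (x0 i) (wx i).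
have Yh i j : (forall l, gb v (Y i j l)) /\ (forall l,
    psderiv (Y i j l) + \sum_l' expand v (G l l') (a i) * Y i j l' = 0).
  by apply/(horizontalP Hv Hc small); have [] := Ybasis i.
pose comb (c : 'I_d * 'I_r -> k) lm := \sum_ij psC (c ij) * F ij.1 ij.2 lm.
have combE c lm n : comb c lm n = \sum_ij c ij * F ij.1 ij.2 lm n.
  by rewrite /comb ps_sumE; apply: eq_bigr => ij _; rewrite psCmulE.
have Wcomb c i l : W (comb c) i l =
    \sum_j psC (c (i, j)) * pscomp (Y i j l) (w i).
  transitivity (\sum_ij psC (c ij) * W (F ij.1 ij.2) i l).
    rewrite (eq_bigr _ (fun ij _ => mulr_sumr _ _ _ _)) exchange_big /=.
    by apply: eq_bigr => m _; rewrite mulr_sumr; apply: eq_bigr => ij _; ring.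
  transitivity (\sum_i' \sum_j (i == i')%:R * (psC (c (i', j)) * pscomp (Y i' j l) (w i'))).
    by rewrite pair_bigA; apply: eq_bigr => -[i' j] _; rewrite WF /=; ring.
  rewrite (bigD1 i)//= [X in _ + X]big1 ?addr0 => [|i' /negPf].
    by apply: eq_bigr => j _; rewrite eqxx mul1r.
  by rewrite eq_sym => ->; rewrite big1// => j _; rewrite mul0r.
have Wcombx c i l : pscomp (W (comb c) i l) (x i) = \sum_j psC (c (i, j)) * Y i j l.
  rewrite Wcomb pscomp_sum//; apply: eq_bigr => j _.
  by rewrite pscompM// pscompC// Yx.
split.
- case=> i0 j; apply/(horizontalP Hv Hc small); split=> [[l m]|[l m]].
    exact: (gbM Hv (gV _ _) (gb_comp Hv ((Yh i0 j).1 _) (gw i0) (w0 i0))).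
  (* The defect vanishes once its [W] components do. Injectivity of substitution and the nonzero
     constant term of [psderiv (x i)] reduce this to the equation satisfied at a_i by the pullback,
     which is [Y i0 j] for i = i0 and 0 otherwise. *)
  rewrite -[LHS]/(E (F i0 j) (l, m)) VW big1// => i _.
  rewrite (_ : W _ i l = 0) ?mulr0//.
  apply: (pscomp_eq0 (x0 i) (x1 i)); apply: (@ps_lreg _ (psderiv (x i))).
    by rewrite /psderiv mulr1.
  rewrite ode !WF; have [->|/negPf ne] := eqVneq i i0.
    rewrite mul1r Yx -[RHS]((Yh i0 j).2 l); congr (_ + _); apply: eq_bigr => l' _.
    by rewrite WF eqxx mul1r Yx.
  rewrite mul0r pscomp0// big1 ?addr0; first by apply: psP => n; rewrite /psderiv mul0r.
  by move=> l' _; rewrite WF ne mul0r pscomp0// mulr0.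
- move=> c cF [i j].
  have [_ Yfree _] := Ybasis i; apply: (Yfree (fun j => c (i, j))) => l n.
  (* Pulling back to a_i kills the terms with another first index and leaves a relation among the
     [Y i j]. *)
  transitivity (pscomp (W (comb c) i l) (x i) n).
    by rewrite Wcombx ps_sumE; apply: eq_bigr => j' _; rewrite psCmulE.
  rewrite (_ : W _ _ _ = 0) ?pscomp0// /W big1// => m _.
  by rewrite (_ : comb c _ = 0) ?mulr0//; apply: psP => n'; rewrite combE cF.
move=> Z /(horizontalP Hv Hc small)[gZ odeZ].
(* The pullback of [Z] to each a_i is horizontal for M, so the coefficients can be chosen at each
   a_i independently. *)
have /choice[c cE] i : exists c : 'I_r -> k,
    forall l n, pscomp (W Z i l) (x i) n = \sum_j c j * Y i j l n.
  have [_ _ Yspan] := Ybasis i; apply: (Yspan (fun l => pscomp (W Z i l) (x i))).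
  apply/(horizontalP Hv Hc small); split=> l.
    by apply: (gb_comp Hv) => //; apply: (gb_sum Hv) => m;
      apply: (gbM Hv) => //; apply: (gb_exp Hv).
  rewrite -ode (_ : W _ _ _ = 0) ?pscomp0 ?mulr0// /W big1// => m _.
  by rewrite /E odeZ mulr0.
exists (fun ij => c ij.1 ij.2) => -[l m] n.
(* Injectivity of substituting [x i] brings the equality of pullbacks back to series in s - b. *)
have WE i : W Z i l = W (comb (fun ij => c ij.1 ij.2)) i l.
  apply: (pscomp_inj (x0 i) (x1 i)); rewrite Wcombx; apply: psP => n'.
  by rewrite cE ps_sumE; apply: eq_bigr => j _; rewrite psCmulE.
rewrite -(combE (fun ij => c ij.1 ij.2)) (VW Z) (VW (comb _)).
by congr (_ n); apply: eq_bigr => i _; rewrite WE.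
Qed.
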